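(* Let $n\ge2$ be an integer, $\sigma>0$, and $\alpha,\beta\in(0,1)$. Let $\mathcal{C}_n=\{[i/n,j/n]: i<j \text{ in }\{0,\dots,n\}\}$ and let $T_n$ be the test that rejects $H_0: f\in\mathcal{D}$ when $\max_{I\in\mathcal{C}_n}S_n^I>s_{\alpha,n}$. Let $R>0$ and $s\in(0,2]$. Assume $n^s\sqrt{\log n}\ge R/\sigma$ and, in the case where $s\in(1,2]$, assume moreover that $R\ge 2^{1+2s}\sigma\sqrt{(\log n)/n}$. Then there exists a positive real $C(s,\alpha,\beta)$, only depending on $s$, $\alpha$ and $\beta$, such that $$\rho\bigl(T_n,\mathcal{F}(s,R),\Delta_1\bigr)\le C(s,\alpha,\beta)\,R^{1/(1+2s)}\Bigl(\frac{\sigma^2\log n}{n}\Bigr)^{s/(1+2s)}$$ and, in case $s\in(1,2]$, $$\rho\bigl(T_n,\mathcal{F}(s,R),\Delta_2\bigr)\le C(s,\alpha,\beta)\,R^{3/(1+2s)}\Bigl(\frac{\sigma^2\log n}{n}\Bigr)^{(s-1)/(1+2s)}.$$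
   Context: White noise model: for an integer $n$, a known $\sigma>0$ and an unknown integrable function $f:[0,1]\to\mathbb{R}$, one observes $$F_n(t)=\int_0^t f(x)\,dx+\frac{\sigma}{\sqrt n}W(t),\qquad t\in[0,1],$$ where $W$ is a standard Brownian motion on $[0,1]$ starting at $0$. $\mathbb{P}_f$ denotes probability when the unknown function is $f$. For a continuous function $G:[0,1]\to\mathbb{R}$ and a closed sub-interval $I\subset[0,1]$, $\hat G^I$ denotes the least concave majorant of the restriction of $G$ to $I$; $|I|$ is the length of $I$. Set $$S_n^I=\sqrt{\frac{n}{\sigma^2|I|}}\,\sup_{t\in I}\bigl(\hat F_n^I(t)-F_n(t)\bigr),$$ and let $s_{\alpha,n}$ be the $(1-\alpha)$-quantile of $\max_{I\in\mathcal{C}_n}\frac{1}{\sqrt{|I|}}\sup_{t\in I}\bigl(\hat W^I(t)-W(t)\bigr)$. $\mathcal{D}$ is the set of non-increasing functions from $[0,1]$ to $\mathbb{R}$. Hölder classes: for $R>0$ and $s\in(0,1]$, $\mathcal{F}(s,R)$ is the set of functions $f:[0,1]\to\mathbb{R}$ with $|f(u)-f(v)|\le R|u-v|^s$ for all $u,v\in[0,1]$; for $R>0$ and $s\in(1,2]$, $\mathcal{F}(s,R)$ is the set of differentiable functions $f:[0,1]\to\mathbb{R}$ with $f'\in\mathcal{F}(s-1,R)$. Criteria: $\Delta_1(f)=\inf_{g\in\mathcal{D}}\sup_{t\in[0,1]}|f(t)-g(t)|$ and, for differentiable $f$, $\Delta_2(f)=\sup_{t\in[0,1]}f'(t)$.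 Uniform separation rate of a test $\Phi$ over a class $\mathcal{F}$ with respect to $\Delta$: $$\rho(\Phi,\mathcal{F},\Delta)=\inf\bigl\{\rho>0:\ \mathbb{P}_f(\Phi\text{ rejects }H_0)\ge1-\beta\ \text{ for all } f\in\mathcal{F}\text{ such that }\Delta(f)\ge\rho\bigr\}.$$ *)

(* Defs.v *)
From HB Require Import structures.
From mathcomp Require Import all_boot all_order all_algebra.
From mathcomp Require Import all_classical all_reals all_analysis.

Set Implicit Arguments.
Unset Strict Implicit.
Unset Printing Implicit Defensive.

Import Order.TTheory GRing.Theory Num.Theory.
Import numFieldNormedType.Exports.

Local Open Scope classical_set_scope.
Local Open Scope ring_scope.

(* Functions on [0, 1] are represented by total functions R -> R; every
   definition below depends only on their values on [0, 1]. *)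

Section BrownianMotion.
Context {d : measure_display} {T : measurableType d} {R : realType}.
Variable P : probability T R.

(* The A i range over all measurable sets, including setT, so the product rule
   over the whole family entails it for every subfamily. *)
Definition mutually_independent (I : finType) (X : I -> T -> R) : Prop :=
  forall A : I -> set R, (forall i, measurable (A i)) ->
    (P (\bigcap_i (X i @^-1` A i)) = \prod_i P (X i @^-1` A i))%E.

(* All sample paths, not just almost all, start at 0 and are continuous on
   [0, 1]: this makes path functionals such as the test statistic below
   measurable on a possibly incomplete probability space. The second argument
   of normal_prob is the standard deviation. *)
Definition brownian_motion01 (W : R -> {RV P >-> R}) : Prop :=
  [/\ forall w, W 0 w = 0,
      forall w, {within `[0, 1], continuous (fun t => W t w)},
      forall u v, 0 <= u -> u < v -> v <= 1 ->
        forall A : set R, measurable A ->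
          P ((W v \- W u) @^-1` A) = normal_prob 0 (Num.sqrt (v - u)) A
    & forall (k : nat) (u : nat -> R),
        0 <= u 0%N -> (forall i, (i < k)%N -> u i < u i.+1) -> u k <= 1 ->
        mutually_independent (fun i : 'I_k => W (u i.+1) \- W (u i))].

(* Real inf: for 0 < p < 1 and X measurable the set is nonempty and bounded
   below. *)
Definition quantile (X : T -> R) (p : R) : R :=
  inf [set x | (p%:E <= P [set w | (X w <= x)%R])%E].

End BrownianMotion.

Section LocalConcaveMajorants.
Context {R : realType}.
Implicit Types (G h : R -> R) (a b t : R).

Definition concave_majorant G a b h : Prop :=
  convex_function (`[a, b]%classic : set R^o) (\- h) /\
  (forall t, t \in `[a, b] -> G t <= h t).

Definition least_concave_majorant G a b t : R :=
  inf [set h t | h in concave_majorant G a b].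

Lemma least_concave_majorant_le G a b h t :
  concave_majorant G a b h -> t \in `[a, b] ->
  least_concave_majorant G a b t <= h t.
Proof.
move=> hG tab; apply: ge_inf; last by exists h.
by exists (G t) => _ [g [_ gG] <-]; exact: gG.
Qed.

Lemma least_concave_majorantP G a b (B : R) :
  (forall t, t \in `[a, b] -> G t <= B) ->
  concave_majorant G a b (least_concave_majorant G a b).
Proof.
move=> GB.
have ne t : [set h t | h in concave_majorant G a b] !=set0.
  exists B, (fun=> B) => //; split => // p x y _ _.
  by rewrite !convRE /= -mulrDl addrC subrK mul1r.
have glb t z : (forall h, concave_majorant G a b h -> z <= h t) ->
    z <= least_concave_majorant G a b t.
  by move=> zh; apply: lb_le_inf => // _ [h hG <-]; exact: zh.
have := @least_concave_majorant_le G a b.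
move: (least_concave_majorant G a b) glb => m glb mle.
split; last by move=> t tab; apply: glb => h [_]; exact.
move=> p x y xab yab; rewrite convRE /= !mulrN -opprD lerN2.
apply: glb => h hG.
have := hG.1 p x y xab yab; rewrite convRE /= !mulrN -opprD lerN2.
apply: le_trans; apply: lerD; apply: ler_wpM2l => //.
- by apply: mle => //; rewrite inE in xab.
- by rewrite subr_ge0.
- by apply: mle => //; rewrite inE in yab.
Qed.

(* Finite when G is continuous on [a, b]. *)
Definition lcm_gap G a b : R :=
  sup [set least_concave_majorant G a b t - G t | t in `[a, b]].

(* Maximum of S over the intervals [i/n, j/n], 0 <= i < j <= n. The seed is the
   value at [0/n, n/n], a member of the collection as soon as n > 0, so it does
   not affect the maximum. *)
Definition max_intervals (n : nat) (S : R -> R -> R) : R :=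
  \big[Num.max/S 0 1]_(ij : 'I_n.+1 * 'I_n.+1 | (ij.1 < ij.2)%N)
    S (ij.1%:R / n%:R) (ij.2%:R / n%:R).

End LocalConcaveMajorants.

Section Test.
Context {d : measure_display} {T : measurableType d} {R : realType}.
Variables (P : probability T R) (W : R -> {RV P >-> R}).
Variables (n : nat) (sigma : R).

Definition observation (f : R -> R) (w : T) (t : R) : R :=
  \int[lebesgue_measure]_(x in `[0, t]) f x + sigma / Num.sqrt n%:R * W t w.

Definition local_stat (f : R -> R) (w : T) (a b : R) : R :=
  Num.sqrt (n%:R / (sigma ^+ 2 * (b - a))) * lcm_gap (observation f w) a b.

Definition noise_max (w : T) : R :=
  max_intervals n
    (fun a b => (Num.sqrt (b - a))^-1 * lcm_gap (fun t => W t w) a b).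

Definition critical_value (alpha : R) : R := quantile P noise_max (1 - alpha).

(* The event that the test rejects when the unknown function is f. *)
Definition Tn_rejects (alpha : R) (f : R -> R) : set T :=
  [set w | critical_value alpha < max_intervals n (local_stat f w)].

(* P_f(test rejects) is modelled as P (reject f): the observation is driven by
   the same noise under every f. *)
Definition separation_rate (reject : (R -> R) -> set T) (beta : R)
    (F : set (R -> R)) (Delta : (R -> R) -> \bar R) : \bar R :=
  ereal_inf [set rho%:E | rho in [set rho : R | 0 < rho /\
    forall f, F f -> (rho%:E <= Delta f)%E ->
      ((1 - beta)%:E <= P (reject f))%E]].

End Test.

Section Classes.
Context {R : realType}.
Implicit Types f g : R -> R.

Definition nonincreasing01 : set (R -> R) :=
  [set g | {in `[0, 1] &, {homo g : x y / x <= y >-> y <= x}}].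

(* Difference quotients at t, restricted to [0, 1]; one-sided at 0 and 1. *)
Definition diff_quot01 f (t : R) : set_system R :=
  (fun u => (f u - f t) / (u - t)) @ within `[0, 1] t^'.

Definition derivable01 f : Prop :=
  forall t, t \in `[0, 1] -> cvg (diff_quot01 f t).

Definition deriv01 f (t : R) : R := lim (diff_quot01 f t).

Definition holder01 (s M : R) : set (R -> R) :=
  [set f | {in `[0, 1] &, forall u v, `|f u - f v| <= M * `|u - v| `^ s}].

(* Meant for 0 < s <= 2. *)
Definition holder_class (s M : R) : set (R -> R) :=
  if s <= 1 then holder01 s M
  else [set f | derivable01 f /\ holder01 (s - 1) M (deriv01 f)].

Definition Delta1 f : \bar R :=
  ereal_inf [set ereal_sup [set (`|f t - g t|)%:E | t in `[0, 1]]
            | g in nonincreasing01].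

Definition Delta2 f : \bar R :=
  ereal_sup [set (deriv01 f t)%:E | t in `[0, 1]].

End Classes.

(* Main.v *)
Require Import Defs.
From mathcomp Require Import all_boot all_order all_algebra.
From mathcomp Require Import all_classical all_reals all_analysis.
From mathcomp Require Import measurable_realfun lra.
Import Order.TTheory GRing.Theory Num.Theory.
Import numFieldNormedType.Exports.

(** Write [eps = sigma * sqrt (ln n / n)], [F t] for the integral of [f] over
    [[0, t]], and let the chord excess of a function at [u < t < v] be the height
    at [t] of its chord over [[u, v]] minus its value at [t].

    The gap between a continuous function and its least concave majorant on an
    interval is the supremum of the chord excesses inside this interval
    ([lcm_gap_leP]). Two things follow. By continuity the supremum may be taken
    over rational points, so the test statistics are measurable. And since the
    chord excess is linear in the function, the gap of the observation is at
    least a chord excess of [F], minus the fluctuation of the noise.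

    This fluctuation is controlled on all the intervals of the grid at once: with
    probability close to 1, [W] oscillates by at most [K * sqrt (ln n)] times
    [sqrt |I|] on every grid interval [I] ([brownian_grid_modulus]). The proof is
    chaining along dyadic points with Gaussian tails, where union bounds suffice;
    the [n ^ 2] intervals are what the factor [sqrt (ln n)] pays for. Used once
    for [alpha], this bounds the critical value by a multiple of [sqrt (ln n)];
    used once for [beta], it shows that the test rejects with probability at
    least [1 - beta] whenever a chord excess of [F] inside some grid interval [I]
    is larger than a multiple of [eps * sqrt |I|] ([Tn_power]).

    It remains to see what is known of [f] when no chord excess is that large,
    which then holds up to constants on every interval longer than [1 / n]
    ([grid_small_gaps]). The chord excess at a midpoint compares the averages of
    [f] over the two halves, so the average of [f] over [[x, x + 2 l]] exceeds
    that over [[x, x + l]] by at most a multiple of [eps / sqrt l]. Doubling the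
    scale repeatedly, from [x] to the right and from [y] to the left, until both
    averages are taken over [[x, y]], shows that the average of [f] near [y]
    exceeds that near [x] by at most a multiple of [eps / sqrt l]
    ([average_spread]): the costs form a geometric series, whatever the distance
    from [x] to [y]. If [f] rises by at most [B] over lengths at most [2 l], then
    [f y - f x] is at most [2 B + C * eps / sqrt l] ([rise_le]), and this bounds
    the distance from [f] to the non-increasing functions ([Delta1_le_rise]).

    For [s <= 1], [B] is of order [M * l ^ s] by definition of the class. For
    [s > 1] the derivative is not bounded over the class, but small gaps
    bound it from above: a derivative larger than [M * l ^ (s - 1)] at one point
    stays positive on a window of length [l], and a steep rise on a window forces
    a large chord excess ([slope_le]). Hence [deriv01 f] is at most a multiple of
    [M * l ^ (s - 1) + eps / l ^ (3 / 2)] ([holder_deriv_le]), which is the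
    statement about [Delta2] and makes [B] of order [M * l ^ s] again.

    Both bounds are optimised by the [l] with [M * l ^ s = eps / sqrt l], which
    yields the two rates ([bandwidthP]). The assumption on [n ^ s * sqrt (ln n)]
    says that this [l] is at least [1 / n], and the assumption for [s > 1] makes
    a window of length [l] fit into [[0, 1]]. *)

Set Implicit Arguments.
Unset Strict Implicit.
Unset Printing Implicit Defensive.

Local Open Scope classical_set_scope.
Local Open Scope ring_scope.

(** * Least concave majorants and chords *)

Section LeastConcaveMajorant.
Context {R : realType}.
Local Open Scope convex_scope.
Implicit Types (G h : R -> R) (a b t u v x : R).

Lemma within_itvP G a b : {within `[a, b], continuous G} <->
  forall t, t \in `[a, b] -> forall e, 0 < e -> exists2 r, 0 < r &
    forall u, u \in `[a, b] -> `|u - t| < r -> `|G u - G t| < e.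
Proof.
split.
  move=> /subspace_continuousP cG t tab e e0.
  have /cvgrPdist_lt/(_ _ e0) := cG _ tab.
  rewrite near_withinE => /nbhs_ballP[r /= r0 rP]; exists r => // u uab ut.
  by rewrite distrC; apply: rP => //=; rewrite /ball /= distrC.
move=> H; apply/subspace_continuousP => t tab.
apply/cvgrPdist_lt => e e0; have [r r0 rP] := H _ tab _ e0.
rewrite near_withinE; apply/nbhs_ballP; exists r => //= u.
by rewrite /ball /= distrC => ut uab; rewrite distrC; exact: rP.
Qed.

Lemma concave_majorantP G a b h : concave_majorant G a b h <->
  (forall p x y, 0 <= p -> p <= 1 -> x \in `[a, b] -> y \in `[a, b] ->
     p * h x + (1 - p) * h y <= h (p * x + (1 - p) * y)) /\
  (forall t, t \in `[a, b] -> G t <= h t).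
Proof.
split=> -[hC hG]; split => //.
  move=> p x y p0 p1 xab yab.
  have xab' : x \in `[a, b]%classic by rewrite inE.
  have yab' : y \in `[a, b]%classic by rewrite inE.
  have : - h (p * x + (1 - p) * y) <= p * - h x + (1 - p) * - h y
    := hC (Itv01 p0 p1) x y xab' yab'.
  by rewrite !mulrN -opprD lerN2.
move=> p x y; rewrite !inE /= => xab yab.
suff : - h (p%:num * x + (1 - p%:num) * y)
    <= p%:num * - h x + (1 - p%:num) * - h y by [].
by rewrite !mulrN -opprD lerN2; exact: hC.
Qed.

(** The height of the chord over [[u, v]] above [G] at [t], multiplied by
    [v - u]: it is then affine in each of the pairs [(u, G u)], [(t, G t)] and
    [(v, G v)]. *)
Definition chord_excess G u t v : R :=
  (v - t) * G u + (t - u) * G v - (v - u) * G t.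

(** At an endpoint of the interval the majorant is allowed to jump: a concave
    function on a closed interval may drop at its ends. Hence the least concave
    majorant touches [G] there, although affine majorants need not come close. *)
Lemma concave_majorant_jump G a b t B : (t == a) || (t == b) ->
  (forall u, u \in `[a, b] -> G u <= B) -> t \in `[a, b] ->
  concave_majorant G a b (fun u => if u == t then G t else B).
Proof.
move=> tE GB tab; apply/concave_majorantP; split=> [p x y p0 p1|u uab]; last first.
  by case: eqP => [->|_]; [exact: lexx|exact: GB].
rewrite !in_itv /= => /andP[ax xb] /andP[ay yb].
have BG := GB _ tab.
set hx := if x == t then _ else _; set hy := if y == t then _ else _.
have hxB : hx <= B by rewrite /hx; case: ifP.
have hyB : hy <= B by rewrite /hy; case: ifP.
have [zt|_] := eqVneq; last by nra.
have [Ex Ey] : p * (x - t) = 0 /\ (1 - p) * (y - t) = 0.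
  by case/orP: tE => /eqP ?; subst t; split; nra.
suff [-> ->] : p * hx = p * G t /\ (1 - p) * hy = (1 - p) * G t by lra.
split.
  have [->|/negbTE q0] := eqVneq p 0; first by rewrite !mul0r.
  by move/eqP: Ex; rewrite mulf_eq0 q0 /= subr_eq0 /hx => ->.
have [->|/negbTE q0] := eqVneq (1 - p) 0; first by rewrite !mul0r.
by move/eqP: Ey; rewrite mulf_eq0 q0 /= subr_eq0 /hy => ->.
Qed.

Lemma concave_majorant_affine G a b (c m : R) :
  (forall t, t \in `[a, b] -> G t <= c + m * t) ->
  concave_majorant G a b (fun t => c + m * t).
Proof.
move=> Gle; apply/concave_majorantP; split => // p x y _ _ _ _.
by lra.
Qed.

(** If no chord excess is above [x], the lines from the point [(t, G t + x)] to
    the graph of [G] on its right are less steep than those to the graph on its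
    left, so a line through this point lies above [G]. *)
Lemma lcm_gap_leP G a b x : a < b -> {within `[a, b], continuous G} ->
  lcm_gap G a b <= x <->
  0 <= x /\ forall u t v, a <= u -> u < t -> t < v -> v <= b ->
    chord_excess G u t v <= x * (v - u).
Proof.
move=> ab cG.
have [c1 _ c1P] := EVT_max (ltW ab) cG.
have [c2 _ c2P] := EVT_min (ltW ab) cG.
set B := G c1 in c1P; set B' := G c2 in c2P.
have mP := least_concave_majorantP c1P.
have aab : a \in `[a, b] by rewrite in_itv /= lexx ltW.
have cB : concave_majorant G a b (fun t => B + 0 * t).
  by apply: concave_majorant_affine => t tab; rewrite mul0r addr0; exact: c1P.
split=> [gx|[x0 H]].
  have gapx t : t \in `[a, b] -> least_concave_majorant G a b t - G t <= x.
    move=> tab; apply: le_trans gx; apply: ub_le_sup; last by exists t.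
    exists (B - B') => _ [z zab <-]; apply: lerB; last exact: c2P.
    by have := least_concave_majorant_le cB zab; rewrite mul0r addr0.
  split; first by apply: le_trans (gapx _ aab); rewrite subr_ge0; exact: mP.2.
  move=> u t v au ut tv vb.
  have uv : 0 < v - u by lra.
  pose p := (v - t) / (v - u).
  have p0 : 0 <= p by rewrite divr_ge0 //; lra.
  have p1 : p <= 1 by rewrite ler_pdivrMr //; lra.
  have pE : p * (v - u) = v - t by rewrite divfK // gt_eqF.
  have uab : u \in `[a, b] by rewrite in_itv /=; apply/andP; split; lra.
  have vab : v \in `[a, b] by rewrite in_itv /=; apply/andP; split; lra.
  have tab : t \in `[a, b] by rewrite in_itv /=; apply/andP; split; lra.
  have [cm mG] := (concave_majorantP _ _ _ _).1 mP.
  have := cm _ u v p0 p1 uab vab.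
  have -> : p * u + (1 - p) * v = t by lra.
  have := gapx _ tab; have := mG _ uab; have := mG _ vab.
  move: (least_concave_majorant G a b) => m h1 h2 h3 h4.
  rewrite /chord_excess.
  have -> : t - u = (1 - p) * (v - u) by lra.
  have -> : v - t = p * (v - u) by [].
  suff : p * G u + (1 - p) * G v - G t <= x by nra.
  nra.
apply: ge_sup; first by exists (least_concave_majorant G a b a - G a), a.
move=> _ [t /= tab <-].
have [tE|] := boolP ((t == a) || (t == b)).
  have := least_concave_majorant_le (concave_majorant_jump tE c1P tab) tab.
  by rewrite eqxx; lra.
rewrite negb_or => /andP[ta tb].
have at' : a < t by move: tab; rewrite in_itv /= lt_def ta => /andP[].
have tb' : t < b by move: tab; rewrite in_itv /= lt_neqAle tb => /andP[].
(* The supremum of the slopes to the right separates them from the slopes to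
   the left, which bound it. *)
pose slopes := [set (G v - (G t + x)) / (v - t) | v in `]t, b]].
pose m := sup slopes.
have slle u : a <= u -> u < t -> ubound slopes ((G t + x - G u) / (t - u)).
  move=> au ut _ [v /= vtb <-]; move: vtb; rewrite in_itv /= => /andP[tv vb].
  rewrite ler_pdivlMr ?subr_gt0 // mulrAC ler_pdivrMr ?subr_gt0 //.
  have := H u t v au ut tv vb; rewrite /chord_excess; nra.
have sl0 : slopes !=set0.
  by exists ((G b - (G t + x)) / (b - t)), b => //=; rewrite in_itv /= tb' lexx.
have hG : concave_majorant G a b (fun u => (G t + x - m * t) + m * u).
  apply: concave_majorant_affine => u uab.
  have [ut|tu|<-] := ltgtP u t; last by lra.
  - have au : a <= u by move: uab; rewrite in_itv /= => /andP[].
    have : m <= (G t + x - G u) / (t - u) by apply: ge_sup => //; exact: slle.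
    by rewrite ler_pdivlMr ?subr_gt0 //; lra.
  - have ub : u <= b by move: uab; rewrite in_itv /= => /andP[].
    have : (G u - (G t + x)) / (u - t) <= m.
      apply: ub_le_sup; first by eexists; exact: slle (lexx a) at'.
      by exists u => //=; rewrite in_itv /= tu ub.
    by rewrite ler_pdivrMr ?subr_gt0 //; lra.
have := least_concave_majorant_le hG tab; lra.
Qed.

End LeastConcaveMajorant.

(** * Measurability of the gap to the least concave majorant *)

Section MaxIntervals.
Context {R : realType}.

Lemma max_intervals_leP n (S : R -> R -> R) x : (0 < n)%N ->
  max_intervals n S <= x <->
  forall i j, (i < j)%N -> (j <= n)%N -> S (i%:R / n%:R) (j%:R / n%:R) <= x.
Proof.
move=> n0; have nn0 : (n%:R : R) != 0 by rewrite pnatr_eq0 -lt0n.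
split=> [/bigmax_leP[_ H] i j ij jn|H].
  have ln : (i < n.+1)%N by apply: ltn_trans ij _; rewrite ltnS.
  have jn' : (j < n.+1)%N by rewrite ltnS.
  exact: (H (Ordinal ln, Ordinal jn')).
apply/bigmax_leP; split; last by case=> i j /= ij; apply: H; rewrite // -ltnS.
by have := H 0%N n n0 (leqnn n); rewrite mul0r divff.
Qed.

End MaxIntervals.

Section GapMeasurability.
Context {R : realType}.
Implicit Types (G : R -> R) (a b t u v x : R).

(** The form [A + B * y + C * G y] is that of the chord excess as a function of
    any one of its three points, the other two being fixed. *)
Lemma rat_affine_le0 G a b c e (A B C : R) : {within `[a, b], continuous G} ->
  a <= c -> c < e -> e <= b ->
  (forall q : rat, c < ratr q -> ratr q < e ->
     A + B * ratr q + C * G (ratr q) <= 0) ->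
  forall y, c <= y -> y <= e -> A + B * y + C * G y <= 0.
Proof.
move=> /within_itvP cG ac ce eb H y cy ye; rewrite leNgt; apply/negP => pos.
set z := A + B * y + C * G y in pos.
have yab : y \in `[a, b] by rewrite in_itv /=; apply/andP; split; lra.
have C1 : 0 < `|C| + 1 by have := normr_ge0 C; lra.
have B1 : 0 < `|B| + 1 by have := normr_ge0 B; lra.
pose k := z / 2 / (`|C| + 1).
have k0 : 0 < k by rewrite !divr_gt0.
have [r r0 rP] := cG _ yab _ k0.
pose r' := Num.min r (z / 2 / (`|B| + 1)).
have r'0 : 0 < r' by rewrite lt_min r0 !divr_gt0.
have : Num.max c (y - r') < Num.min e (y + r').
  by rewrite lt_min !gt_max; apply/andP; split; apply/andP; split; lra.
move=> /rat_in_itvoo[q]; rewrite in_itv /= lt_min gt_max.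
move=> /andP[/andP[cq yq] /andP[qe qy]].
have qyr : `|ratr q - y| < r' by rewrite ltr_norml; apply/andP; split; lra.
have qab : ratr q \in `[a, b] by rewrite in_itv /=; apply/andP; split; lra.
move: (qyr); rewrite lt_min => /andP[qr qB].
have := rP _ qab qr; have := H q cq qe.
rewrite ltr_pdivlMr // in qB; rewrite ltr_pdivlMr //.
move: qB; set w := ratr q; move=> qB h1 h2.
have : `|B * (w - y) + C * (G w - G y)| < z.
  apply: le_lt_trans (ler_normD _ _) _; rewrite !normrM.
  have := normr_ge0 (w - y); have := normr_ge0 (G w - G y).
  nra.
rewrite ltr_norml => /andP[h3 _]; rewrite /z in h3; lra.
Qed.

(** The three points are moved from rational to real values one at a time, the
    left one first. *)
Lemma chord_excess_rat G a b x : {within `[a, b], continuous G} ->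
  (forall p q r : rat, a < ratr p -> ratr p < ratr q :> R ->
     ratr q < ratr r :> R -> ratr r < b ->
     chord_excess G (ratr p) (ratr q) (ratr r) <= x * (ratr r - ratr p)) ->
  forall u t v, a <= u -> u < t -> t < v -> v <= b ->
    chord_excess G u t v <= x * (v - u).
Proof.
move=> cG H.
have H1 u (q r : rat) : a <= u -> u < ratr q -> ratr q < ratr r :> R ->
    ratr r < b -> chord_excess G u (ratr q) (ratr r) <= x * (ratr r - u).
  move=> au uq qr rb; set t := ratr q in uq qr *; set v := ratr r in qr rb *.
  have := @rat_affine_le0 G a b a t (t * G v - v * G t - x * v)
    (- G v + G t + x) (v - t) cG (lexx a) _ _ _ u au (ltW uq).
  rewrite /chord_excess => K.
  suff : t * G v - v * G t - x * v + (- G v + G t + x) * u + (v - t) * G u <= 0.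
    by lra.
  apply: K; [lra|lra|move=> p ap pt].
  by have := H p q r ap pt qr rb; rewrite /chord_excess -/t -/v; lra.
have H2 u (q : rat) v : a <= u -> u < ratr q -> ratr q < v ->
    v <= b -> chord_excess G u (ratr q) v <= x * (v - u).
  move=> au uq qv vb; set t := ratr q in uq qv *.
  have := @rat_affine_le0 G a b t b (- t * G u + u * G t + x * u)
    (G u - G t - x) (t - u) cG _ _ (lexx b) _ v (ltW qv) vb.
  rewrite /chord_excess => K.
  suff : - t * G u + u * G t + x * u + (G u - G t - x) * v + (t - u) * G v <= 0.
    by lra.
  apply: K; [lra|lra|move=> p ap pt].
  by have := H1 u q p au uq ap pt; rewrite /chord_excess -/t; lra.
move=> u t v au ut tv vb.
have := @rat_affine_le0 G a b u v (v * G u - u * G v - x * (v - u))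
  (- G u + G v) (- (v - u)) cG au _ vb _ t (ltW ut) (ltW tv).
rewrite /chord_excess => K.
suff : v * G u - u * G v - x * (v - u) + (- G u + G v) * t + - (v - u) * G t <= 0.
  by lra.
apply: K; [lra|move=> p ap pt].
by have := H2 u p v au ap pt vb; rewrite /chord_excess; lra.
Qed.

Lemma measurable_lcm_gap_le d (T : measurableType d) (X : R -> T -> R) a b x :
  a < b -> (forall t, t \in `[a, b] -> measurable_fun setT (X t)) ->
  (forall w, {within `[a, b], continuous (X^~ w)}) ->
  measurable [set w | lcm_gap (X^~ w) a b <= x].
Proof.
move=> ab mX cX.
have [x0|x0] := ltP x 0.
  rewrite (_ : [set w | _] = set0) // -subset0 => w /= /(lcm_gap_leP _ ab (cX w)).
  by case; lra.
pose D (c : rat * rat * rat) := [&& a < ratr c.1.1, ratr c.1.1 < ratr c.1.2 :> R,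
  ratr c.1.2 < ratr c.2 :> R & ratr c.2 < b].
pose F (c : rat * rat * rat) w :=
  chord_excess (X^~ w) (ratr c.1.1) (ratr c.1.2) (ratr c.2).
pose E (c : rat * rat * rat) : set T := if D c then
  F c @^-1` `]-oo, x * (ratr c.2 - ratr c.1.1)] else setT.
have -> : [set w | lcm_gap (X^~ w) a b <= x] = \bigcap_c E c.
  apply/seteqP; split=> w /=.
    move=> /(lcm_gap_leP _ ab (cX w))[_ H] c _; rewrite /E.
    case: ifP => // /and4P[h1 h2 h3 h4].
    by rewrite /= in_itv /=; apply: H => //; exact: ltW.
  move=> H; apply/(lcm_gap_leP _ ab (cX w)); split=> //.
  apply: chord_excess_rat => // p q r h1 h2 h3 h4.
  have := H (p, q, r) I; rewrite /E /D /= h1 h2 h3 h4 /=.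
  by rewrite in_itv.
rewrite -(setCK (\bigcap_c E c)) setC_bigcap; apply: measurableC.
apply: countable_bigcupT_measurable => // c; apply: measurableC; rewrite /E.
case: ifP => // /and4P[h1 h2 h3 h4].
rewrite -[X in measurable X]setTI.
have m1 (k y : R) : y \in `[a, b] -> measurable_fun setT (fun w => k * X y w).
  by move=> yab; apply: measurable_funM => //; exact: mX.
suff : measurable_fun setT (F c) by apply.
rewrite /F /chord_excess.
apply: measurable_funB; first apply: measurable_funD.
all: by apply: m1; rewrite in_itv /=; apply/andP; split; lra.
Qed.

End GapMeasurability.

(** * Gaussian tails *)

Section GaussianTail.
Context {R : realType}.
Local Notation mu := (@lebesgue_measure R).

(** Tilting: the centred density is at most [expR (- m ^+ 2 / (2 * s ^+ 2))]
    times the density centred at [m], as soon as [m ^+ 2 <= m * x]. *)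
Lemma normal_prob_tilt (s m : R) (A : set R) : 0 < s -> measurable A ->
  (forall x, A x -> m ^+ 2 <= m * x) ->
  (normal_prob 0 s A <= (expR (- m ^+ 2 / (2 * s ^+ 2)))%:E)%E.
Proof.
move=> s0 mA Am; rewrite /normal_prob.
have sn : s != 0 by rewrite gt_eqF.
have mpdf k : measurable_fun setT (fun x => (normal_pdf k s x)%:E).
  by apply/measurable_EFinP; exact: measurable_normal_pdf.
set e := expR _.
have e0 : 0 <= e by exact: expR_ge0.
apply: (@le_trans _ _ (\int[mu]_(x in A) (e%:E * (normal_pdf m s x)%:E))%E).
  apply: ge0_le_integral => //.
  - by move=> x _; rewrite lee_fin normal_pdf_ge0.
  - by apply: measurable_funTS; exact: mpdf.
  - by apply: measurable_funTS; apply: measurable_funeM; exact: mpdf.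
  - move=> x Ax; rewrite -EFinM lee_fin !normal_pdfE //.
    rewrite mulrCA ler_wpM2l ?normal_peak_ge0 // /normal_fun -expRD ler_expR.
    rewrite subr0 -mulr_natl -mulrDl ler_pM2r ?invr_gt0; last first.
      by rewrite [2%:R * _]mulrC mulr_gt0 // exprn_gt0.
    by have := Am _ Ax; nra.
rewrite ge0_integralZl_EFin //; first last.
- by apply: measurable_funTS; exact: mpdf.
- by move=> x _; rewrite lee_fin normal_pdf_ge0.
rewrite -[leRHS]mule1; apply: (@lee_wpmul2l R e%:E); first by rewrite lee_fin.
apply: (@le_trans _ _ (\int[mu]_x (normal_pdf m s x)%:E)%E); last first.
  by rewrite integral_normal_pdf.
apply: ge0_subset_integral => //; first exact: mpdf.
by move=> x _; rewrite lee_fin normal_pdf_ge0.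
Qed.

Lemma measurable_normr_gt (c : R) : measurable [set x : R | c < `|x|].
Proof.
have -> : [set x : R | c < `|x|] = (fun x : R => `|x|) @^-1` `]c, +oo[.
  by apply/seteqP; split=> x /=; rewrite in_itv /= andbT.
rewrite -[X in measurable X]setTI; exact: normr_measurable.
Qed.

Lemma normal_prob_tail (s y : R) : 0 < s -> 0 <= y ->
  (normal_prob 0 s [set x | (y < `|x|)%R] <=
   (2 * expR (- y ^+ 2 / (2 * s ^+ 2)))%:E)%E.
Proof.
move=> s0 y0.
have -> : [set x : R | y < `|x|] = `]y, +oo[ `|` `]-oo, (- y)[.
  apply/seteqP; split=> x /=; rewrite !in_itv /= andbT lter_normr ltrNr.
    by case/orP; [left|right].
  by case=> ->; rewrite ?orbT.
apply: le_trans (measureU2 (normal_prob 0 s) _ _) _ => //.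
rewrite mulrDl mul1r EFinD; apply: leeD.
  apply: normal_prob_tilt => // x /=; rewrite in_itv /= andbT => yx; nra.
rewrite -[y ^+ 2]sqrrN; apply: normal_prob_tilt => // x /=.
by rewrite in_itv /= => yx; nra.
Qed.

End GaussianTail.

(** * Chaining along dyadic points *)

Section DyadicChaining.
Context {R : realType}.
Implicit Types (g : R -> R) (a b c t : R).

Definition dyadic_node a b (k m : nat) : R := a + m%:R / 2 ^+ k * (b - a).

Lemma dyadic_node_double a b k m :
  dyadic_node a b k.+1 m.*2 = dyadic_node a b k m.
Proof.
rewrite /dyadic_node -muln2 natrM exprS invfM mulrA -[m%:R * 2 / 2]mulrA.
by rewrite divff // mulr1.
Qed.

Lemma dyadic_nodeS a b k m :
  dyadic_node a b k m.+1 - dyadic_node a b k m = (b - a) / 2 ^+ k.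
Proof. by rewrite /dyadic_node -natr1 mulrDl mulrDl mul1r mulrC; lra. Qed.

Lemma dyadic_node_itv a b k m : a < b -> (m <= 2 ^ k)%N ->
  dyadic_node a b k m \in `[a, b].
Proof.
move=> ab mk; rewrite in_itv /= /dyadic_node.
have p0 : 0 <= m%:R / 2 ^+ k :> R by rewrite divr_ge0.
have p1 : m%:R / 2 ^+ k <= 1 :> R.
  by rewrite ler_pdivrMr ?exprn_gt0 // mul1r -natrX ler_nat.
by apply/andP; split; nra.
Qed.

Lemma dyadic_chaining_nodes g a b c : 0 <= c ->
  (forall k m, (m < 2 ^ k)%N ->
     `|g (dyadic_node a b k m.+1) - g (dyadic_node a b k m)|
       <= c * (3 / 4) ^+ k) ->
  forall k m, (m <= 2 ^ k)%N ->
    `|g (dyadic_node a b k m) - g a| <= c * (4 - 3 * (3 / 4) ^+ k).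
Proof.
move=> c0 H.
have node00 k : dyadic_node a b k 0 = a by rewrite /dyadic_node !mul0r addr0.
elim=> [|k IH] m.
  rewrite expn0 expr0; case: m => [_|[_|//]].
    by rewrite node00 subrr normr0; nra.
  by have := H 0%N 0%N isT; rewrite node00 expr0; lra.
rewrite expnS => mk.
have q0 : 0 <= (3 / 4 : R) ^+ k by rewrite exprn_ge0.
have -> : m = (odd m + m./2.*2)%N by rewrite odd_double_half.
case: (boolP (odd m)) => [om|om] /=.
  have mk' : (m./2 < 2 ^ k)%N.
    rewrite -(ltn_pmul2l (isT : (0 < 2)%N)); apply: leq_trans mk.
    by rewrite mul2n -[X in (_ < X)%N]odd_double_half om.
  have := IH _ (ltnW mk'); rewrite -dyadic_node_double.
  have mk2 : (m./2.*2 < 2 ^ k.+1)%N by rewrite expnS mul2n ltn_double.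
  have := H k.+1 _ mk2.
  rewrite add1n exprS.
  set A := g _; set B := g _ => h1 h2.
  have -> : A - g a = (A - B) + (B - g a) by lra.
  by apply: le_trans (ler_normD _ _) _; nra.
rewrite add0n dyadic_node_double.
apply: le_trans (IH _ _) _; last by rewrite exprS; nra.
by rewrite (leq_trans (half_leq mk)) // mul2n doubleK.
Qed.

(** Any ratio in the interval from [sqrt (1 / 2)] to 1 would do in place of
    [3 / 4]: the increments of a Brownian motion at level [k] are of order
    [sqrt (1 / 2) ^ k], so they exceed a multiple of [(3 / 4) ^ k] with a
    probability summable over all levels and nodes, while these thresholds sum
    to 4. *)
Lemma dyadic_chaining g a b c : a < b -> {within `[a, b], continuous g} ->
  0 <= c ->
  (forall k m, (m < 2 ^ k)%N ->
     `|g (dyadic_node a b k m.+1) - g (dyadic_node a b k m)|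
       <= c * (3 / 4) ^+ k) ->
  forall t, t \in `[a, b] -> `|g t - g a| <= 4 * c.
Proof.
move=> ab /within_itvP cg c0 H t tab; apply/ler_addgt0Pr => e e0.
have [r r0 rP] := cg _ tab _ e0.
have ba : 0 < b - a by rewrite subr_gt0.
pose k := (Num.truncn ((b - a) / r)).+1.
have k2 : (b - a) / 2 ^+ k < r.
  rewrite ltr_pdivrMr ?exprn_gt0 // mulrC -ltr_pdivrMr //.
  apply: (@lt_trans _ _ k%:R).
    by have /andP[] := truncn_itv (divr_ge0 (ltW ba) (ltW r0)).
  by rewrite -natrX ltr_nat ltn_expl.
pose x := (t - a) / (b - a) * 2 ^+ k.
have [at' tb] : a <= t /\ t <= b by move: tab; rewrite in_itv /= => /andP[].
have x0 : 0 <= x by rewrite mulr_ge0 ?exprn_ge0 // divr_ge0 // subr_ge0 // ltW.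
have /andP[mx xm] := truncn_itv x0; set m := Num.truncn x in mx xm.
have xk : x <= 2 ^+ k.
  by rewrite ler_piMl ?exprn_ge0 // ler_pdivrMr // mul1r lerD2r.
have mk : (m <= 2 ^ k)%N by rewrite -(ler_nat R) natrX (le_trans mx).
have xE : x / 2 ^+ k * (b - a) = t - a.
  by rewrite mulfK ?divfK // gt_eqF // exprn_gt0.
have nt : `|dyadic_node a b k m - t| < r.
  apply: le_lt_trans k2; rewrite ler_norml.
  have i0 : 0 < (b - a) / 2 ^+ k by rewrite divr_gt0 ?exprn_gt0.
  have -> : dyadic_node a b k m - t = (m%:R - x) * ((b - a) / 2 ^+ k).
    have -> : t = a + x / 2 ^+ k * (b - a) by lra.
    rewrite /dyadic_node opprD addrACA subrr add0r -!mulrBl -mulrA.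
    by rewrite [_^-1 * _]mulrC.
  by rewrite -natr1 in xm; apply/andP; split; nra.
have h1 := rP _ (dyadic_node_itv ab mk) nt.
have h2 := dyadic_chaining_nodes c0 H mk.
have q0 : 0 <= (3 / 4 : R) ^+ k by rewrite exprn_ge0.
move: h1 h2; set A := g _ => h1 h2.
have -> : g t - g a = (A - g a) - (A - g t) by lra.
by apply: le_trans (ler_normB _ _) _; nra.
Qed.

End DyadicChaining.

(** * Oscillations of Brownian motion on an interval *)

Section GoodEvent.
Context {R : realType}.

Lemma bernoulli_nine_eighths k : 1 + k%:R / 8 <= (9 / 8 : R) ^+ k.
Proof.
elim: k => [|k IH]; first by rewrite mul0r addr0 expr0.
by rewrite exprS -natr1; have := ler0n R k; lra.
Qed.

Lemma finite_union_bound d (T : measurableType d) (P : probability T R)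
    (n : nat) (F : nat -> set T) (e : R) :
  (forall i, (i < n)%N -> measurable (F i)) ->
  (forall i, (i < n)%N -> (P (F i) <= e%:E)%E) ->
  (P (\big[setU/set0]_(i < n) F i) <= (n%:R * e)%:E)%E.
Proof.
move=> mF Pe; apply: le_trans (Boole_inequality P mF) _.
apply: (@le_trans _ _ (\sum_(i < n) e%:E)%E).
  by apply: lee_sum => i _; exact: Pe.
by rewrite sumEFin sumr_const card_ord mulr_natl.
Qed.

Context {d : measure_display} {T : measurableType d} (P : probability T R).
Variable W : R -> {RV P >-> R}.
Hypothesis WB : brownian_motion01 W.

Implicit Types (u v a b c : R).

Lemma measurable_increment_gt u v c :
  measurable [set w | c < `|W v w - W u w| ].
Proof.
rewrite (_ : [set w | _] = (W v \- W u) @^-1` [set x | c < `|x|]) //.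
rewrite -[X in measurable X]setTI; apply: measurable_funB => //.
exact: measurable_normr_gt.
Qed.

Lemma brownian_increment_tail u v c : 0 <= u -> u < v -> v <= 1 -> 0 <= c ->
  (P [set w | (c < `|W v w - W u w|)%R]
     <= (2 * expR (- c ^+ 2 / (2 * (v - u))))%:E)%E.
Proof.
move=> u0 uv v1 c0; case: WB => _ _ /(_ u v u0 uv v1) WN _.
rewrite (_ : [set w | _] = (W v \- W u) @^-1` [set x | c < `|x|]) //.
have uv0 : 0 <= v - u by rewrite subr_ge0 ltW.
rewrite (WN _ (measurable_normr_gt c)) -[v - u in leRHS]sqr_sqrtr //.
by apply: normal_prob_tail; rewrite ?sqrtr_gt0 ?subr_gt0.
Qed.

(** With the threshold [l * (3 / 4) ^ k] on the normalised increments at level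
    [k], the Gaussian exponent is [l ^ 2 * (9 / 8) ^ k / 2], which is at least
    [l ^ 2 * (8 + k) / 16]: an increment is bad with probability at most
    [2 * z ^ (8 + k)], and [z <= 1 / 4] beats the [2 ^ k] increments. *)
Lemma brownian_interval_sup a b (l : R) : 0 <= a -> a < b -> b <= 1 -> 0 <= l ->
  let z := expR (- l ^+ 2 / 16) in z <= 1 / 4 ->
  exists B : set T, [/\ measurable B, (P B <= (4 * z ^+ 8)%:E)%E &
    forall w, ~ B w -> forall t, t \in `[a, b] ->
      `|W t w - W a w| <= 4 * (l * Num.sqrt (b - a))].
Proof.
move=> a0 ab b1 l0 z z4.
have z0 : 0 < z by exact: expR_gt0.
have ba : 0 < b - a by rewrite subr_gt0.
pose c := l * Num.sqrt (b - a).
have c0 : 0 <= c by rewrite mulr_ge0 ?sqrtr_ge0.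
pose bad k m := [set w | c * (3 / 4) ^+ k <
  `|W (dyadic_node a b k m.+1) w - W (dyadic_node a b k m) w|].
have mbad k m : measurable (bad k m) by exact: measurable_increment_gt.
pose level k := \big[setU/set0]_(m < 2 ^ k) bad k m.
have mlevel k : measurable (level k) by apply: bigsetU_measurable.
have Pbad k m : (m < 2 ^ k)%N -> (P (bad k m) <= (2 * z ^+ (8 + k))%:E)%E.
  move=> mk.
  have h1 := dyadic_node_itv ab (ltnW mk); have h2 := dyadic_node_itv ab mk.
  have hd := dyadic_nodeS a b k m.
  have dk : 0 < (b - a) / 2 ^+ k by rewrite divr_gt0 ?exprn_gt0.
  rewrite !in_itv /= in h1 h2; case/andP: h1 => h1 _; case/andP: h2 => _ h2.
  have q0 : 0 <= c * (3 / 4) ^+ k by rewrite mulr_ge0 ?exprn_ge0.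
  apply: le_trans (@brownian_increment_tail _ _ _ _ _ _ q0) _; [lra|lra|lra|].
  rewrite hd lee_fin ler_pM2l // /z -expRM_natl ler_expR.
  have -> : - (c * (3 / 4) ^+ k) ^+ 2 / (2 * ((b - a) / 2 ^+ k))
      = - l ^+ 2 / 2 * (9 / 8) ^+ k.
    have -> : (9 / 8 : R) ^+ k = ((3 / 4) ^+ k) ^+ 2 * 2 ^+ k.
      by rewrite -exprM mulnC exprM -exprMn; congr (_ ^+ k); lra.
    rewrite /c; set q := _ ^+ k; set y := 2 ^+ k.
    have y0 : 0 < y by rewrite exprn_gt0.
    have e0 : 0 < (b - a) / y by rewrite divr_gt0.
    have eE : (b - a) / y * y = Num.sqrt (b - a) ^+ 2.
      by rewrite sqr_sqrtr ?ltW // divfK // gt_eqF.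
    move: e0 eE; move: ((b - a) / y) => e; set r := Num.sqrt _ => e0 eE.
    apply: (mulIf (x := 2 * e)); first by rewrite gt_eqF // mulr_gt0.
    have e2 : 2 * e != 0 by rewrite gt_eqF // mulr_gt0.
    rewrite (divfK e2).
    have -> : - l ^+ 2 / 2 * (q ^+ 2 * y) * (2 * e)
        = - l ^+ 2 * q ^+ 2 * (e * y) by lra.
    by rewrite eE; lra.
  rewrite natrD; have := bernoulli_nine_eighths k.
  have : 0 <= l ^+ 2 by rewrite sqr_ge0.
  nra.
have Plevel k : (P (level k) <= (4 * z ^+ 8 / (2 ^ k.+1)%:R)%:E)%E.
  apply: le_trans (finite_union_bound (fun m _ => mbad k m) (Pbad k)) _.
  have zk : z ^+ k * 2 ^+ k * 2 ^+ k <= 1.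
    rewrite -!exprMn; apply: exprn_ile1; last by lra.
    by rewrite !mulr_ge0 // ltW.
  have z8 : 0 <= z ^+ 8 by rewrite exprn_ge0 // ltW.
  rewrite lee_fin !natrX exprD [2 ^+ k.+1]exprS ler_pdivlMr ?mulr_gt0 ?exprn_gt0 //.
  by have := ler_wpM2l z8 zk; lra.
pose B := \bigcup_k level k.
have mB : measurable B by apply: bigcup_measurable => k _.
exists B; split => //.
  apply: le_trans (measure_sigma_subadditive P mlevel mB (@subset_refl _ B)) _.
  apply: le_trans (epsilon_trick0 xpredT _); last first.
    by rewrite mulr_ge0 // exprn_ge0 // ltW.
  by apply: lee_nneseries => // k _; exact: Plevel.
move=> w nB; apply: dyadic_chaining => //.
  case: WB => _ cW _ _; apply: continuous_subspaceW (cW w) => t /=.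
  by rewrite !in_itv /= => /andP[? ?]; apply/andP; split; lra.
move=> k m mk; rewrite leNgt; apply/negP => badw; apply: nB; exists k => //.
by rewrite /level -bigcup_mkord; exists m.
Qed.

End GoodEvent.

(** * Oscillations of Brownian motion on the grid *)

Section GridModulus.
Context {R : realType}.

(** The level [l] of [brownian_interval_sup] is taken with
    [l ^ 2 = 16 * q * ln n], so that [z = n ^ (- q)]. Then [z ^ 2] compensates the
    number of grid intervals, and what remains is at most [2 ^ (- q)], hence at
    most [gamma] for a [q] that depends on [gamma] only. *)
Lemma brownian_grid_modulus (gamma : R) : 0 < gamma ->
  exists2 K : R, 0 < K &
  forall (d : measure_display) (T : measurableType d) (P : probability T R)
    (W : R -> {RV P >-> R}) (n : nat), brownian_motion01 W -> (2 <= n)%N ->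
  exists A : set T, [/\ measurable A, ((1 - gamma)%:E <= P A)%E &
    forall w, A w -> forall i j t, (i < j)%N -> (j <= n)%N ->
      t \in `[i%:R / n%:R, j%:R / n%:R] ->
      `|W t w - W (i%:R / n%:R) w|
        <= K * Num.sqrt (ln n%:R) * Num.sqrt (j%:R / n%:R - i%:R / n%:R)].
Proof.
move=> g0.
pose q := (Num.truncn gamma^-1).+2.
have q2 : 2^-1 ^+ q <= gamma.
  rewrite exprVn -[leRHS]invrK lef_pV2 ?posrE ?invr_gt0 ?exprn_gt0 //.
  have ig0 : 0 <= gamma^-1 by rewrite invr_ge0 ltW.
  have /andP[_ /ltW gq] := truncn_itv ig0; apply: le_trans gq _.
  by rewrite -natrX ler_nat; apply: ltnW; apply: ltn_trans (ltn_expl _ _).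
have q0 : 0 < q%:R :> R by [].
exists (4 * Num.sqrt (16 * q%:R)); first by rewrite mulr_gt0 // sqrtr_gt0 mulr_gt0.
move=> d T P W n WB n2.
have n2R : 2 <= n%:R :> R by rewrite ler_nat.
have n0 : 0 < n%:R :> R by lra.
have L0 : 0 < ln (n%:R : R) by rewrite ln_gt0 //; lra.
pose v : R := n%:R^-1.
have v0 : 0 < v by rewrite invr_gt0.
have vn : n%:R * v = 1 by rewrite divff // gt_eqF.
have v2 : v <= 1 / 2 by nra.
pose l : R := Num.sqrt (16 * q%:R) * Num.sqrt (ln n%:R).
have l0 : 0 <= l by rewrite mulr_ge0 ?sqrtr_ge0.
pose z := expR (- l ^+ 2 / 16).
have zE : z = v ^+ q.
  rewrite /z /l exprMn !sqr_sqrtr ?mulr_ge0 ?ltW //.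
  have -> : - (16 * q%:R * ln n%:R) / 16 = q%:R * - ln (n%:R : R) by lra.
  by rewrite expRM_natl expRN lnK.
have z0 : 0 < z by exact: expR_gt0.
have zv2 : z <= v ^+ 2.
  by rewrite zE; apply: ler_wiXn2l => //; [exact: ltW|lra].
have z4 : z <= 1 / 4 by nra.
have zg : z <= gamma.
  by apply: le_trans q2; rewrite zE ler_pXn2r ?nnegrE ?(ltW v0) //; lra.
have n1v : (n.+1)%:R * z <= 1.
  by rewrite -natr1; have : (n%:R + 1) * v ^+ 2 <= 1; nra.
have total : n.+1%:R * (n.+1%:R * (4 * z ^+ 8)) <= gamma.
  apply: le_trans zg.
  have n10 : 0 <= n.+1%:R :> R by [].
  have a2 : n.+1%:R * z * (n.+1%:R * z) <= 1.
    by rewrite mulr_ile1 // mulr_ge0 // ltW.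
  have a4 : z ^+ 4 <= 1 by apply: exprn_ile1; [exact: ltW|lra].
  have a5 : z ^+ 5 <= 1 / 4.
    by rewrite exprS; apply: le_trans (ler_piMr (ltW z0) a4) _.
  have a50 : 0 <= z ^+ 5 by rewrite exprn_ge0 // ltW.
  have -> : n.+1%:R * (n.+1%:R * (4 * z ^+ 8))
    = (n.+1%:R * z * (n.+1%:R * z)) * (4 * z * z ^+ 5).
    by lra.
  have h1 : 4 * z * z ^+ 5 <= z by nra.
  have h0 : 0 <= 4 * z * z ^+ 5 by rewrite !mulr_ge0 // ltW.
  exact: le_trans (ler_piMl h0 a2) h1.
have HB (ij : nat * nat) : exists B : set T, [/\ measurable B,
    (P B <= (4 * z ^+ 8)%:E)%E &
    (ij.1 < ij.2)%N -> (ij.2 <= n)%N -> forall w, ~ B w ->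
    forall t, t \in `[ij.1%:R / n%:R, ij.2%:R / n%:R] ->
      `|W t w - W (ij.1%:R / n%:R) w|
        <= 4 * (l * Num.sqrt (ij.2%:R / n%:R - ij.1%:R / n%:R))].
  have [ijn|nij] := boolP ((ij.1 < ij.2)%N && (ij.2 <= n)%N); last first.
    exists set0; split => //.
      by rewrite measure0 lee_fin mulr_ge0 // exprn_ge0 // ltW.
    by move=> h1 h2; rewrite h1 h2 in nij.
  case/andP: ijn => lt_ij jn.
  have a0 : 0 <= ij.1%:R / n%:R :> R by rewrite divr_ge0.
  have ab : ij.1%:R / n%:R < ij.2%:R / n%:R :> R.
    by rewrite ltr_pM2r ?invr_gt0 // ltr_nat.
  have b1 : ij.2%:R / n%:R <= 1 :> R by rewrite ler_pdivrMr // mul1r ler_nat.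
  have [B [mB PB HB]] := brownian_interval_sup WB a0 ab b1 l0 z4.
  by exists B; split.
have [B HB'] := choice HB.
pose B0 := \big[setU/set0]_(i < n.+1) \big[setU/set0]_(j < n.+1) B (val i, val j).
have mB ij : measurable (B ij) by case: (HB' ij).
have mBi i : measurable (\big[setU/set0]_(j < n.+1) B (i, val j)).
  by apply: bigsetU_measurable.
have mB0 : measurable B0 by apply: bigsetU_measurable => i _; exact: mBi.
exists (~` B0); split; first exact: measurableC.
  rewrite probability_setC // EFinB; apply: leeB => //.
  apply: (@le_trans _ _ (n.+1%:R * (n.+1%:R * (4 * z ^+ 8)))%:E); last first.
    by rewrite lee_fin.
  apply: (@finite_union_bound _ _ _ P n.+1
    (fun i => \big[setU/set0]_(j < n.+1) B (i, val j))) => [i _|i _].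
    exact: mBi.
  apply: (@finite_union_bound _ _ _ P n.+1 (fun j => B (i, j))) => // j _.
  by case: (HB' (i, j)).
move=> w nB i j t ij jn tij.
have [_ _ H] := HB' (i, j).
rewrite -mulrA -[_ * _ in leRHS]mulrA mulrA -/l.
rewrite -!mulrA [Num.sqrt _ * (Num.sqrt _ * _)]mulrA.
apply: (H ij jn) => // Bw; apply: nB.
rewrite /B0 -(bigcup_mkord n.+1 (fun i => \big[setU/set0]_(j < n.+1) B (i, val j))).
exists i; first by rewrite /= (ltn_trans ij).
rewrite -(bigcup_mkord n.+1 (fun j => B (i, j))); exists j => //=.
Qed.

End GridModulus.

(** * Power of the test in terms of chord excesses *)

Section RejectionEvent.
Context {R : realType}.
Implicit Types (G : R -> R) (a b c t u v x : R).

Lemma chord_excess_bounded G a b c k : 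
  (forall t, t \in `[a, b] -> `|G t - c| <= k) ->
  forall u t v, a <= u -> u < t -> t < v -> v <= b ->
  `|chord_excess G u t v| <= 2 * k * (v - u).
Proof.
move=> H u t v au ut tv vb.
have h x : a <= x -> x <= b -> - k <= G x - c <= k.
  by move=> ax xb; rewrite -ler_norml; apply: H; rewrite in_itv /= ax.
have /andP[u1 u2] : - k <= G u - c <= k by apply: h; lra.
have /andP[t1 t2] : - k <= G t - c <= k by apply: h; lra.
have /andP[v1 v2] : - k <= G v - c <= k by apply: h; lra.
have -> : chord_excess G u t v =
  (v - t) * (G u - c) + (t - u) * (G v - c) - (v - u) * (G t - c).
  by rewrite /chord_excess; lra.
rewrite ler_norml; apply/andP; split; nra.
Qed.

Lemma chord_excessD G H c u t v :
  chord_excess (fun y => G y + c * H y) u t v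
    = chord_excess G u t v + c * chord_excess H u t v.
Proof. by rewrite /chord_excess; lra. Qed.

Lemma lcm_gap_ge0 G a b : a < b -> {within `[a, b], continuous G} ->
  0 <= lcm_gap G a b.
Proof.
by move=> ab cG; have /(lcm_gap_leP _ ab cG)[] := lexx (lcm_gap G a b).
Qed.

Lemma grid_itv (n i j : nat) : (i < j)%N -> (j <= n)%N ->
  [/\ 0 <= i%:R / n%:R :> R, i%:R / n%:R < j%:R / n%:R :> R
    & j%:R / n%:R <= 1 :> R].
Proof.
move=> ij jn; have n0 : (0 < n)%N by apply: leq_trans jn; apply: leq_trans ij.
have n0R : 0 < n%:R :> R by rewrite ltr0n.
by split; rewrite ?divr_ge0 // ?ltr_pM2r ?invr_gt0 ?ltr_nat //
  ler_pdivrMr // mul1r ler_nat.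
Qed.

Lemma within_itvW G a b : 0 <= a -> b <= 1 ->
  {within `[0, 1], continuous G} -> {within `[a, b], continuous G}.
Proof.
move=> a0 b1; apply: continuous_subspaceW => t /=.
by rewrite !in_itv /= => /andP[? ?]; apply/andP; split; lra.
Qed.

Section Measurability.
Context {d : measure_display} {T : measurableType d}.

Lemma measurable_max_intervals_le (n : nat) (S : T -> R -> R -> R) x : (0 < n)%N ->
  (forall i j, (i < j)%N -> (j <= n)%N ->
    measurable [set w | S w (i%:R / n%:R) (j%:R / n%:R) <= x]) ->
  measurable [set w | max_intervals n (S w) <= x].
Proof.
move=> n0 mS.
pose E (ij : nat * nat) : set T := if (ij.1 < ij.2)%N && (ij.2 <= n)%N
  then [set w | S w (ij.1%:R / n%:R) (ij.2%:R / n%:R) <= x] else setT.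
have -> : [set w | max_intervals n (S w) <= x] = \bigcap_ij E ij.
  apply/seteqP; split=> w /=.
    move=> /(max_intervals_leP _ _ n0) H ij _; rewrite /E.
    by case: ifP => // /andP[ij1 ijn]; exact: H.
  move=> H; apply/(max_intervals_leP _ _ n0) => i j ij jn.
  by have := H (i, j) I; rewrite /E /= ij jn.
rewrite -(setCK (\bigcap_ij E ij)) setC_bigcap; apply: measurableC.
apply: countable_bigcupT_measurable => // ij; apply: measurableC; rewrite /E.
by case: ifP => // /andP[ij1 ijn]; exact: mS.
Qed.

Context {P : probability T R} {W : R -> {RV P >-> R}}.
Hypothesis WB : brownian_motion01 W.

Let cW w : {within `[0, 1], continuous (fun t => W t w)}.
Proof. by case: WB. Qed.

Lemma measurable_noise_max_le n x : (0 < n)%N ->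
  measurable [set w | noise_max W n w <= x].
Proof.
move=> n0; apply: measurable_max_intervals_le => // i j ij jn.
have [a0 ab b1] := grid_itv ij jn.
set a := _ / _ in a0 ab *; set b := j%:R / _ in ab b1 *.
have D0 : 0 < Num.sqrt (b - a) by rewrite sqrtr_gt0 subr_gt0.
under eq_set => w do rewrite mulrC ler_pdivrMr //.
apply: measurable_lcm_gap_le => // w; exact: within_itvW.
Qed.

Lemma noise_max_ge0 n w : (0 < n)%N -> 0 <= noise_max W n w.
Proof.
move=> n0; have /(max_intervals_leP _ _ n0) := lexx (noise_max W n w).
move=> /(_ 0%N n n0 (leqnn n)); apply: le_trans.
have [a0 ab b1] := @grid_itv n 0 n n0 (leqnn n).
by rewrite mulr_ge0 ?invr_ge0 ?sqrtr_ge0 // lcm_gap_ge0 //; exact: within_itvW.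
Qed.

Lemma within_observation n sigma f w :
  {within `[0, 1],
    continuous (fun t => \int[lebesgue_measure]_(x in `[0, t]) f x)} ->
  {within `[0, 1], continuous (observation W n sigma f w)}.
Proof.
move=> cF; rewrite /observation => t.
by apply: cvgD; [exact: cF|apply: cvgM; [exact: cvg_cst|exact: cW]].
Qed.

Lemma measurable_Tn_rejects n sigma alpha f : (0 < n)%N -> 0 < sigma ->
  {within `[0, 1],
    continuous (fun t => \int[lebesgue_measure]_(x in `[0, t]) f x)} ->
  measurable (Tn_rejects W n sigma alpha f).
Proof.
move=> n0 s0 cF.
have n0R : 0 < n%:R :> R by rewrite ltr0n.
rewrite (_ : Tn_rejects _ _ _ _ _ = ~` [set w |
  max_intervals n (local_stat W n sigma f w) <= critical_value W n alpha]);
  last first.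
  by apply/seteqP; split=> w; rewrite /Tn_rejects /= ltNge => /negP.
apply: measurableC; apply: measurable_max_intervals_le => // i j ij jn.
have [a0 ab b1] := grid_itv ij jn.
set a := _ / _ in a0 ab *; set b := j%:R / _ in ab b1 *.
have D0 : 0 < Num.sqrt (n%:R / (sigma ^+ 2 * (b - a))).
  by rewrite sqrtr_gt0 divr_gt0 // mulr_gt0 ?exprn_gt0 // subr_gt0.
under eq_set => w do rewrite /local_stat -ler_pdivlMl //.
apply: (measurable_lcm_gap_le (X := fun t w => observation W n sigma f w t)) => //.
  move=> t _; apply: measurable_funD => //; exact: measurable_funM.
by move=> w; apply: within_itvW => //; exact: within_observation.
Qed.

Lemma critical_value_le n alpha (x : R) : (0 < n)%N -> alpha < 1 ->
  ((1 - alpha)%:E <= P [set w | (noise_max W n w <= x)%R])%E ->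
  critical_value W n alpha <= x.
Proof.
move=> n0 a1 Px; rewrite /critical_value /quantile; apply: ge_inf => //.
(* The noise statistic is nonnegative, so that 0 bounds the quantile set. *)
exists 0 => y /= Py; rewrite leNgt; apply/negP => y0; move: Py.
rewrite (_ : [set w | _] = set0) ?measure0 ?lee_fin; first by lra.
by rewrite -subset0 => w /=; have := noise_max_ge0 w n0; lra.
Qed.

End Measurability.

(** The noise enters twice, each time through its modulus on the grid: in the
    critical value, with probability [1 - alpha], and in the gap of the
    observation, with probability [1 - beta]. *)
Lemma Tn_power (alpha beta : R) : 0 < alpha < 1 -> 0 < beta < 1 ->
  exists2 K : R, 0 < K &
  forall (d : measure_display) (T : measurableType d) (P : probability T R)
    (W : R -> {RV P >-> R}) (n : nat) (sigma : R) (f : R -> R),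
  let F t := \int[lebesgue_measure]_(x in `[0, t]) f x in
  brownian_motion01 W -> (2 <= n)%N -> 0 < sigma ->
  {within `[0, 1], continuous F} ->
  (exists i j u t v, [/\ (i < j)%N, (j <= n)%N,
    [/\ i%:R / n%:R <= u, u < t, t < v & v <= j%:R / n%:R] &
    K * (sigma / Num.sqrt n%:R * Num.sqrt (ln n%:R))
      * Num.sqrt (j%:R / n%:R - i%:R / n%:R) * (v - u) < chord_excess F u t v]) ->
  ((1 - beta)%:E <= P (Tn_rejects W n sigma alpha f))%E.
Proof.
move=> /andP[a0 a1] /andP[b0 b1].
have [Ka Ka0 HA] := @brownian_grid_modulus R alpha a0.
have [Kb Kb0 HB] := @brownian_grid_modulus R beta b0.
exists (2 * Ka + 2 * Kb); first by lra.
move=> d T P W n sigma f F WB n2 s0 cF [i [j [u [t [v [ij jn [au ut tv vb] big]]]]]].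
have n0 : (0 < n)%N by apply: leq_trans n2.
have n0R : 0 < n%:R :> R by rewrite ltr0n.
have cW w : {within `[0, 1], continuous (fun t => W t w)} by case: WB.
have [A [mA PA HAw]] := HA _ _ _ _ _ WB n2.
have [B [mB PB HBw]] := HB _ _ _ _ _ WB n2.
have mrej := measurable_Tn_rejects WB alpha n0 s0 cF.
set L := Num.sqrt (ln _) in HAw HBw big.
have L0 : 0 <= L by exact: sqrtr_ge0.
have crit : critical_value W n alpha <= 2 * Ka * L.
  apply: (critical_value_le WB) => //; apply: le_trans PA _.
  apply: le_measure; rewrite ?inE //; first exact: measurable_noise_max_le.
  move=> w Aw /=; apply/(max_intervals_leP _ _ n0) => k l kl ln.
  have [x0 xy y1] := grid_itv kl ln.
  have H := HAw w Aw k l _ kl ln.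
  move: x0 xy y1 H; set x := k%:R / _; set y := l%:R / _ => x0 xy y1 H.
  have D0 : 0 < Num.sqrt (y - x) by rewrite sqrtr_gt0 subr_gt0.
  rewrite mulrC ler_pdivrMr //; apply/lcm_gap_leP => //; first exact: within_itvW.
  split; first by rewrite !mulr_ge0 // ltW.
  move=> u' t' v' h1 h2 h3 h4.
  have := chord_excess_bounded H h1 h2 h3 h4.
  by rewrite ler_norml => /andP[_]; rewrite !mulrA.
apply: le_trans PB _; apply: le_measure; rewrite ?inE // => w Bw.
rewrite /Tn_rejects /= ltNge; apply/negP => nrej.
have := le_trans nrej crit => /(max_intervals_leP _ _ n0)/(_ i j ij jn).
have [x0 xy y1] := grid_itv ij jn.
have H := HBw w Bw i j _ ij jn.
move: x0 xy y1 H au vb big; set x := i%:R / _; set y := j%:R / _.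
move=> x0 xy y1 H au vb big.
have D0 : 0 < Num.sqrt (y - x) by rewrite sqrtr_gt0 subr_gt0.
have yx0 : 0 <= y - x by rewrite subr_ge0 ltW.
have sn0 : 0 < Num.sqrt n%:R :> R by rewrite sqrtr_gt0.
rewrite /local_stat.
have -> : Num.sqrt (n%:R / (sigma ^+ 2 * (y - x))) =
    (sigma / Num.sqrt n%:R * Num.sqrt (y - x))^-1.
  rewrite sqrtrM ?ltW // sqrtrV ?mulr_ge0 ?ltW ?subr_gt0 //.
  rewrite sqrtrM ?sqr_ge0 // sqrtr_sqr gtr0_norm //.
  by rewrite !invfM invrK mulrCA mulrA.
have c0 : 0 < sigma / Num.sqrt n%:R by rewrite divr_gt0.
set c := sigma / _ in c0 big *.
rewrite ler_pdivrMl ?(mulr_gt0 c0 D0) //.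
move=> /(lcm_gap_leP _ xy (within_itvW x0 y1 (within_observation WB cF))).
case=> _ /(_ u t v au ut tv vb); rewrite chord_excessD -/F -/c.
have := chord_excess_bounded H au ut tv vb.
rewrite ler_norml => /andP[h1 _] h2.
have := ler_wpM2l (ltW c0) h1.
move: h2 big; set s := Num.sqrt (y - x); set eF := chord_excess F u t v.
set eW := chord_excess _ u t v => h2 big h3.
suff : eF <= (2 * Ka + 2 * Kb) * (c * L) * s * (v - u) by lra.
by lra.
Qed.

End RejectionEvent.

(** * Functions whose primitive has small chord excesses *)

Section SmallGaps.
Context {R : realType}.
Implicit Types (G F f : R -> R) (k l x y u t v : R).

(** The chord excess itself is [chord_excess G u t v / (v - u)]; the bound
    [k * sqrt (v - u)] on it has the scaling of the oscillations of the noise. *)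
Definition small_gaps G l k : Prop :=
  forall u t v, 0 <= u -> u < t -> t < v -> v <= 1 -> l <= v - u ->
    chord_excess G u t v <= k * Num.sqrt (v - u) * (v - u).

Lemma small_gaps_reflect G l k :
  small_gaps G l k -> small_gaps (fun t => G (1 - t)) l k.
Proof.
move=> H u t v u0 ut tv v1 lv.
have -> : chord_excess (fun t => G (1 - t)) u t v
    = chord_excess G (1 - v) (1 - t) (1 - u) by rewrite /chord_excess; lra.
have -> : v - u = (1 - u) - (1 - v) by lra.
by apply: H; lra.
Qed.

(** [(G (x + l) - G x) / l] is the average of [f] over [[x, x + l]] when [G] is a
    primitive of [f]; the chord excess of [G] at the middle of [[x, x + 2 * l]]
    is [l / 2] times the difference between the averages over the two halves. *)
Lemma average_double G l0 k x l : 0 < l0 -> small_gaps G l0 k ->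
  0 <= x -> l0 <= l -> x + 2 * l <= 1 ->
  (G (x + 2 * l) - G x) / (2 * l)
    <= (G (x + l) - G x) / l + k * Num.sqrt 2 / Num.sqrt l.
Proof.
move=> l00 H x0 ll x1.
have l0' : 0 < l by apply: lt_le_trans ll.
have := H x (x + l) (x + 2 * l) x0 ltac:(lra) ltac:(lra) x1 ltac:(lra).
have -> : x + 2 * l - x = 2 * l by lra.
rewrite /chord_excess sqrtrM //.
have s0 : 0 < Num.sqrt l by rewrite sqrtr_gt0.
have sE : Num.sqrt l ^+ 2 = l by rewrite sqr_sqrtr // ltW.
set s := Num.sqrt l in s0 sE *; set r := Num.sqrt 2 => h.
rewrite -lerBlDl -[(G (x + l) - G x) / l](mulKf (_ : 2 != 0 :> R)) //.
have -> : 2^-1 * (2 * ((G (x + l) - G x) / l)) = 2 * (G (x + l) - G x) / (2 * l).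
  by rewrite invfM mulrACA; lra.
rewrite -mulrBl ler_pdivrMr ?mulr_gt0 //.
have -> : k * r / s * (2 * l) = k * r * 2 * s.
  have ks : k * r / s * s = k * r by rewrite divfK // gt_eqF.
  by rewrite -[X in _ = X * _ * _]ks -sE; lra.
rewrite -(ler_pM2r l0').
have -> : k * r * 2 * s * l = k * (r * s) * (2 * l) by lra.
by apply: le_trans h; lra.
Qed.

(** Passing from scale [l] to scale [2 * l] costs [sqrt 2 * k / sqrt l]; the
    costs along the doublings form a geometric series dominated by its first
    term, so that no logarithmic number of scales enters the bound. *)
Lemma average_forward G l0 k x : 0 < l0 -> 0 <= k -> small_gaps G l0 k ->
  0 <= x -> forall m l, l0 <= l -> x + 2 ^+ m * l <= 1 ->
  (G (x + 2 ^+ m * l) - G x) / (2 ^+ m * l)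
    <= (G (x + l) - G x) / l + 5 * (k / Num.sqrt l).
Proof.
move=> l00 k0 H x0; elim=> [|m IH] l ll.
  rewrite expr0 mul1r => _; rewrite lerDl mulr_ge0 // divr_ge0 // sqrtr_ge0.
have l0' : 0 < l by apply: lt_le_trans ll.
have -> : 2 ^+ m.+1 * l = 2 ^+ m * (2 * l) by rewrite exprS; lra.
move=> x1; have ll2 : l0 <= 2 * l by lra.
apply: le_trans (IH _ ll2 x1) _.
have m1 : 1 <= 2 ^+ m :> R by apply: exprn_ege1; lra.
have x2 : x + 2 * l <= 1 by nra.
have := average_double l00 H x0 ll x2.
have s0 : 0 < Num.sqrt l by rewrite sqrtr_gt0.
have r0 : 0 < Num.sqrt 2 :> R by rewrite sqrtr_gt0.
have rE : Num.sqrt 2 ^+ 2 = 2 :> R by rewrite sqr_sqrtr.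
have r2 : (Num.sqrt 2)^-1 = Num.sqrt 2 / 2 :> R.
  by rewrite -[2 in X in _ = _ / X]rE expr2 invfM mulrA divff ?mul1r // gt_eqF.
have -> : k / Num.sqrt (2 * l) = k / Num.sqrt l * (Num.sqrt 2 / 2).
  by rewrite sqrtrM // invfM r2; lra.
have -> : k * Num.sqrt 2 / Num.sqrt l = k / Num.sqrt l * Num.sqrt 2 by lra.
have q0 : 0 <= k / Num.sqrt l by rewrite divr_ge0 // ltW.
move: r0 rE q0; set r := Num.sqrt 2; set q := k / _ => r0 rE q0 h.
(* [sqrt 2 + 5 / sqrt 2 <= 5], which is where the constant 5 comes from. *)
have : r <= 10 / 7 by nra.
by nra.
Qed.

(** The averages at scale [2 ^ m * l] to the right of [x] and to the left of [y]
    are the same number. *)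
Lemma average_spread G l0 k x m l y : 0 < l0 -> 0 <= k -> small_gaps G l0 k ->
  0 <= x -> l0 <= l -> x + 2 ^+ m * l = y -> y <= 1 ->
  (G y - G (y - l)) / l <= (G (x + l) - G x) / l + 10 * (k / Num.sqrt l).
Proof.
move=> l00 k0 H x0 ll yE y1; rewrite -yE in y1.
have h1 := average_forward l00 k0 H x0 ll y1.
have y0 : 0 <= 1 - y by lra.
have y1' : 1 - y + 2 ^+ m * l <= 1 by lra.
have := average_forward l00 k0 (small_gaps_reflect H) y0 ll y1'.
have -> : 1 - (1 - y + 2 ^+ m * l) = x by lra.
have -> : 1 - (1 - y + l) = y - l by lra.
have -> : 1 - (1 - y) = y by lra.
have E : x + 2 ^+ m * l = y by []; move: h1; rewrite E; lra.
Qed.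

Lemma dyadic_scale l0 D : 0 < l0 -> l0 <= D ->
  exists m l, [/\ l0 <= l, l < 2 * l0, l <= D & 2 ^+ m * l = D].
Proof.
move=> l0_gt0 lD; have D0 : 0 <= D by lra.
have ex : exists m, D < 2 ^+ m * l0.
  exists (Num.truncn (D / l0)).+1; rewrite -ltr_pdivrMr //.
  have /andP[_ h] := truncn_itv (divr_ge0 D0 (ltW l0_gt0)).
  by apply: lt_trans h _; rewrite -natrX ltr_nat ltn_expl.
case: (ex_minnP ex) => -[|m]; first by rewrite expr0 mul1r ltNge lD.
rewrite exprS => Dm minm.
have p1 : 1 <= 2 ^+ m :> R by apply: exprn_ege1; lra.
have p0 : 0 < 2 ^+ m :> R by lra.
exists m, (D / 2 ^+ m); split.
- by rewrite ler_pdivlMr // mulrC leNgt; apply/negP => /minm; rewrite ltnn.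
- by rewrite ltr_pdivrMr //; lra.
- by rewrite ler_pdivrMr // ler_peMr.
- by rewrite mulrC divfK // gt_eqF.
Qed.

End SmallGaps.

Section Primitive.
Context {R : realType}.
Local Notation mu := (@lebesgue_measure R).
Variable f : R -> R.
Hypothesis fi : mu.-integrable `[0, 1] (EFin \o f).

Definition primitive (t : R) : R := \int[mu]_(x in `[0, t]) f x.

Lemma within_primitive : {within `[0, 1], continuous primitive}.
Proof. exact: (parameterized_integral_continuous ler01 fi). Qed.

Lemma primitive_sub (u v : R) : 0 <= u -> u <= v -> v <= 1 ->
  mu.-integrable `]u, v] (EFin \o f) /\
  primitive v - primitive u = \int[mu]_(x in `]u, v]) f x.
Proof.
move=> u0 uv v1; split.
  apply: integrableS fi => // x /=; rewrite !in_itv /= => /andP[? ?].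
  by apply/andP; split; lra.
rewrite /primitive Rintegral_itvB ?bnd_simp //.
apply: integrableS fi => // x /=; rewrite !in_itv /= => /andP[? ?].
by apply/andP; split; lra.
Qed.

Lemma Rintegral_cst_itv (u v c : R) : u <= v ->
  mu.-integrable `]u, v] (EFin \o cst c) /\ \int[mu]_(_ in `]u, v]) c = c * (v - u).
Proof.
move=> uv; split.
  have : mu.-integrable `[u, v] (EFin \o (cst c : R -> R)).
    apply: continuous_compact_integrable; first exact: segment_compact.
    by move=> x; exact: cvg_cst.
  apply: integrableS => // x /=; rewrite !in_itv /= => /andP[? ?].
  by apply/andP; split; lra.
rewrite Rintegral_cst //; congr (_ * _).
have mE : mu `]u, v] = (if u < v then (v - u)%:E else 0%E).
  by rewrite lebesgue_measure_itv /= lte_fin EFinB.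
apply: etrans (congr1 fine mE) _.
by case: ltgtP uv => //= -> _; rewrite subrr.
Qed.

Lemma primitive_sub_le (u v c : R) : 0 <= u -> u <= v -> v <= 1 ->
  (forall x, u < x -> x <= v -> f x <= c) ->
  primitive v - primitive u <= c * (v - u).
Proof.
move=> u0 uv v1 fc; have [i1 ->] := primitive_sub u0 uv v1.
have [i2 <-] := Rintegral_cst_itv c uv.
apply: le_Rintegral => // x /=; rewrite in_itv /= => /andP[ux xv]; exact: fc.
Qed.

Lemma primitive_sub_ge (u v c : R) : 0 <= u -> u <= v -> v <= 1 ->
  (forall x, u < x -> x <= v -> c <= f x) ->
  c * (v - u) <= primitive v - primitive u.
Proof.
move=> u0 uv v1 fc; have [i1 ->] := primitive_sub u0 uv v1.
have [i2 <-] := Rintegral_cst_itv c uv.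
apply: le_Rintegral => // x /=; rewrite in_itv /= => /andP[ux xv]; exact: fc.
Qed.

(** Only upper bounds on the increments of [f] over short lengths are needed:
    they bound the average to the right of [x] from above by [f x + B], and the
    average to the left of [y] from below by [f y - B]. *)
Lemma rise_le l0 k B : 0 < l0 -> 0 <= k -> small_gaps primitive l0 k -> 0 <= B ->
  (forall u v, 0 <= u -> u <= v -> v <= 1 -> v - u <= 2 * l0 -> f v - f u <= B) ->
  forall x y, 0 <= x -> x <= y -> y <= 1 ->
    f y - f x <= 2 * B + 10 * (k / Num.sqrt l0).
Proof.
move=> l00 k0 H B0 fB x y x0 xy y1.
have s0 : 0 < Num.sqrt l0 by rewrite sqrtr_gt0.
have q0 : 0 <= k / Num.sqrt l0 by rewrite divr_ge0 // ltW.
have [short|long] := ltP (y - x) l0.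
  have : f y - f x <= B by apply: fB => //; lra.
  lra.
have [m [l [l1 l2 ly lE]]] := dyadic_scale l00 long.
have l3 : 0 < l by apply: lt_le_trans l1.
have h1 : primitive (x + l) - primitive x <= (f x + B) * l.
  have -> : (f x + B) * l = (f x + B) * (x + l - x) by congr (_ * _); lra.
  apply: primitive_sub_le; [lra|lra|lra|move=> z xz zl].
  have : f z - f x <= B by apply: fB; lra.
  lra.
have h2 : (f y - B) * l <= primitive y - primitive (y - l).
  have -> : (f y - B) * l = (f y - B) * (y - (y - l)) by congr (_ * _); lra.
  apply: primitive_sub_ge; [lra|lra|lra|move=> z xz zl].
  have : f y - f z <= B by apply: fB; lra.
  lra.
rewrite -(ler_pdivrMr _ _ l3) in h1; rewrite -(ler_pdivlMr _ _ l3) in h2.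
have yE : x + 2 ^+ m * l = y by rewrite lE; lra.
have := average_spread l00 k0 H x0 l1 yE y1.
have : k / Num.sqrt l <= k / Num.sqrt l0.
  by apply: ler_wpM2l => //; rewrite lef_pV2 ?posrE ?sqrtr_gt0 // ler_wsqrtr.
lra.
Qed.

(** On a window of length [l0] where the slope of [f] is at least [A], the
    averages of [f] over the two outer thirds differ by at least [A * l0 / 3];
    this difference is controlled by the gaps at the two division points. *)
Lemma slope_le l0 k A u : 0 < l0 -> small_gaps primitive l0 k ->
  0 <= u -> u + l0 <= 1 -> 0 <= A ->
  (forall x y, u <= x -> x <= y -> y <= u + l0 -> A * (y - x) <= f y - f x) ->
  A * l0 ^+ 2 <= 18 * k * Num.sqrt l0.
Proof.
move=> l00 H u0 u1 A0 fA.
pose l := l0 / 3; have l3 : l0 = 3 * l by rewrite /l; lra.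
have lp : 0 < l by lra.
have lu : u + l0 - u = l0 by lra.
have := @H u (u + l) (u + l0) u0 ltac:(lra) ltac:(lra) u1.
have := @H u (u + 2 * l) (u + l0) u0 ltac:(lra) ltac:(lra) u1.
rewrite !lu => /(_ (lexx _)) g2 /(_ (lexx _)) g1.
have f12 : A * l <= f (u + 2 * l) - f (u + l).
  have := fA (u + l) (u + 2 * l) ltac:(lra) ltac:(lra) ltac:(lra); nra.
have h1 : primitive (u + l) - primitive u <= f (u + l) * l.
  have -> : f (u + l) * l = f (u + l) * (u + l - u) by congr (_ * _); lra.
  apply: primitive_sub_le; [lra|lra|lra|move=> z xz zl].
  have := fA z (u + l) ltac:(lra) ltac:(lra) ltac:(lra).
  have : 0 <= u + l - z by lra.
  nra.
have h2 : f (u + 2 * l) * l <= primitive (u + l0) - primitive (u + 2 * l).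
  have -> : f (u + 2 * l) * l = f (u + 2 * l) * (u + l0 - (u + 2 * l)).
    by congr (_ * _); lra.
  apply: primitive_sub_ge; [lra|lra|lra|move=> z xz zl].
  have := fA (u + 2 * l) z ltac:(lra) ltac:(lra) ltac:(lra).
  have : 0 <= z - (u + 2 * l) by lra.
  nra.
move: g1 g2 h1 h2; rewrite /chord_excess.
have -> : u + l0 - (u + l) = 2 * l by lra.
have -> : u + l - u = l by lra.
have -> : u + l0 - (u + 2 * l) = l by lra.
have -> : u + 2 * l - u = 2 * l by lra.
rewrite lu; set F0 := primitive u; set F1 := primitive (u + l).
set F2 := primitive (u + 2 * l); set F3 := primitive (u + l0).
move: (Num.sqrt l0) => s; rewrite l3 => g1 g2 h1 h2.
have g1' : 2 * F0 + F3 - 3 * F1 <= 3 * k * s.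
  by rewrite -(ler_pM2r lp); lra.
have g2' : F0 + 2 * F3 - 3 * F2 <= 3 * k * s.
  by rewrite -(ler_pM2r lp); lra.
have : A * l * l <= f (u + 2 * l) * l - f (u + l) * l.
  by rewrite -mulrBl ler_pM2r.
lra.
Qed.

End Primitive.

(** * Derivatives on the unit interval and separation criteria *)

Section DerivativeOnUnitInterval.
Context {R : realType}.
Implicit Types (f : R -> R) (t u v A : R).

Lemma deriv01P f t : derivable01 f -> t \in `[0, 1] ->
  forall e, 0 < e -> exists2 r, 0 < r &
    forall u, u \in `[0, 1] -> u != t -> `|u - t| < r ->
      `|(f u - f t) / (u - t) - deriv01 f t| < e.
Proof.
move=> df tab e e0.
have /cvgrPdist_lt/(_ _ e0) : diff_quot01 f t --> deriv01 f t by exact: df.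
rewrite /diff_quot01 near_withinE.
rewrite near_withinE => /nbhs_ballP[r /= r0 rP]; exists r => // u uab ut utr.
by rewrite distrC; apply: rP => //=; rewrite /ball /= distrC.
Qed.

Lemma derivable01_continuous f : derivable01 f -> {within `[0, 1], continuous f}.
Proof.
move=> df; apply/within_itvP => t tab e e0.
have [r r0 rP] := deriv01P df tab ltr01.
pose B := `|deriv01 f t| + 1.
have B0 : 0 < B by rewrite ltr_wpDl.
exists (Num.min r (e / B)) => [|u uab]; first by rewrite lt_min r0 divr_gt0.
rewrite lt_min ltr_pdivlMr // => /andP[ur ue].
have [->|ut] := eqVneq u t; first by rewrite subrr normr0.
have ut0 : u - t != 0 by rewrite subr_eq0.
have -> : f u - f t = (f u - f t) / (u - t) * (u - t) by rewrite divfK.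
rewrite normrM; apply: le_lt_trans ue; rewrite mulrC; apply: ler_wpM2l => //.
have := rP _ uab ut ur; set q := _ / _ => h.
have -> : q = deriv01 f t + (q - deriv01 f t) by lra.
by apply: le_trans (ler_normD _ _) _; rewrite lerD2l ltW.
Qed.

Lemma is_derive_deriv01 f t : derivable01 f -> t \in `]0, 1[ ->
  is_derive t 1 f (deriv01 f t).
Proof.
move=> df; rewrite in_itv /= => /andP[t0 t1].
have tab : t \in `[0, 1] by rewrite in_itv /= !ltW.
suff H : (fun h => h^-1 *: ((f \o shift t) (h *: 1) - f t)) @ 0^' --> deriv01 f t.
  by apply: DeriveDef; [exact: cvgP H|exact: cvg_lim H].
apply/cvgrPdist_lt => e e0.
have [r r0 rP] := deriv01P df tab e0.
rewrite near_withinE; apply/nbhs_ballP.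
exists (Num.min r (Num.min t (1 - t))) => /=.
  by rewrite !lt_min r0 t0 subr_gt0.
move=> h; rewrite /ball /= sub0r normrN !lt_min => /and3P[hr ht ht1] h0.
have /= := rP (h + t) _ _ _; rewrite addrK distrC mulrC -[h *: 1]/(h * 1) mulr1.
apply => //.
  move: ht ht1; rewrite !ltr_norml in_itv /= => /andP[? ?] /andP[? ?].
  by apply/andP; split; lra.
by rewrite -subr_eq0 addrK.
Qed.

Lemma rise_deriv01 f u v : derivable01 f -> 0 <= u -> u <= v -> v <= 1 ->
  exists2 c, c \in `[u, v] & f v - f u = deriv01 f c * (v - u).
Proof.
move=> df u0 uv v1; apply: MVT_segment => // [x|].
  rewrite in_itv /= => /andP[ux xv]; apply: is_derive_deriv01 => //.
  by rewrite in_itv /=; apply/andP; split; lra.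
exact: (within_itvW u0 v1 (derivable01_continuous df)).
Qed.

Lemma holder01_continuous s M f : 0 < s -> 0 < M -> holder01 s M f ->
  {within `[0, 1], continuous f}.
Proof.
move=> s0 M0 hf; apply/within_itvP => t tab e e0.
exists ((e / M) `^ s^-1) => [|u uab ut]; first by rewrite powR_gt0 // divr_gt0.
apply: le_lt_trans (hf _ _ uab tab) _.
rewrite mulrC -ltr_pdivlMr //.
have -> : e / M = ((e / M) `^ s^-1) `^ s.
  by rewrite -powRrM mulVf ?gt_eqF // powRr1 // divr_ge0 // ltW.
by apply: gt0_ltr_powR => //; rewrite nnegrE ?powR_ge0.
Qed.

End DerivativeOnUnitInterval.

Section Criteria.
Context {R : realType}.
Implicit Types (f : R -> R).

(** The least non-increasing function above [f] is [t |-> sup_(y >= t) f y];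
    it exceeds [f] by at most the largest rise of [f]. *)
Lemma Delta1_le_rise f B :
  (forall x y, 0 <= x -> x <= y -> y <= 1 -> f y - f x <= B) ->
  (Delta1 f <= B%:E)%E.
Proof.
move=> H.
pose g t := sup [set f y | y in `[t, 1]].
have bnd t : 0 <= t -> t <= 1 -> ubound [set f y | y in `[t, 1]] (f t + B).
  move=> t0 t1 _ [y /= + <-]; rewrite in_itv /= => /andP[ty y1].
  have := H t y t0 ty y1; lra.
have ne t : t <= 1 -> [set f y | y in `[t, 1]] !=set0.
  by move=> t1; exists (f t), t => //=; rewrite in_itv /= lexx t1.
have gD : nonincreasing01 g.
  move=> x y; rewrite !in_itv /= => /andP[x0 x1] /andP[y0 y1] xy.
  apply: ge_sup; first exact: ne.
  move=> _ [z /= + <-]; rewrite in_itv /= => /andP[yz z1].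
  apply: ub_le_sup; first by exists (f x + B); exact: bnd.
  by exists z => //=; rewrite in_itv /= z1 (le_trans xy).
apply: le_trans (ereal_inf_lbound _) _; first by exists g.
apply: ge_ereal_sup => _ [t /= tab <-]; rewrite lee_fin.
move: tab; rewrite in_itv /= => /andP[t0 t1].
have h1 : f t <= g t.
  apply: ub_le_sup; first by exists (f t + B); exact: bnd.
  by exists t => //=; rewrite in_itv /= lexx t1.
have h2 : g t <= f t + B by apply: ge_sup; [exact: ne|exact: bnd].
by rewrite ler0_norm; lra.
Qed.

Lemma Delta2_le f B : (forall t, t \in `[0, 1] -> deriv01 f t <= B) ->
  (Delta2 f <= B%:E)%E.
Proof. by move=> H; apply: ge_ereal_sup => _ [t /= tab <-]; rewrite lee_fin H. Qed.

(** Every interval of length at least [1 / n] lies in a grid interval at most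
    three times as long. *)
Lemma grid_small_gaps (n : nat) (G : R -> R) k l : (0 < n)%N -> 0 <= k ->
  n%:R^-1 <= l ->
  (forall i j u t v, (i < j)%N -> (j <= n)%N ->
    i%:R / n%:R <= u -> u < t -> t < v -> v <= j%:R / n%:R ->
    chord_excess G u t v <= k * Num.sqrt (j%:R / n%:R - i%:R / n%:R) * (v - u)) ->
  small_gaps G l (2 * k).
Proof.
move=> n0 k0 nl H u t v u0 ut tv v1 lv.
have nR : 0 < n%:R :> R by rewrite ltr0n.
have un0 : 0 <= u * n%:R by rewrite mulr_ge0.
have vn0 : 0 <= v * n%:R by rewrite mulr_ge0; lra.
have /andP[i1 i2] := truncn_itv un0; set i := Num.truncn _ in i1 i2.
have /andP[j1 j2] := truncn_itv vn0; set m := Num.truncn _ in j1 j2.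
pose j := minn m.+1 n.
have uvn : u * n%:R < v * n%:R by rewrite ltr_pM2r //; lra.
have vn : v * n%:R <= n%:R by rewrite ler_piMl // ltW.
have vj : v * n%:R <= j%:R by rewrite /j /minn; case: ifP => // _; exact: ltW.
have ij : (i < j)%N.
  by rewrite -(ltr_nat R); apply: le_lt_trans i1 _; apply: lt_le_trans uvn _.
have jn : (j <= n)%N by exact: geq_minr.
have jm : j%:R <= v * n%:R + 1.
  by apply: (@le_trans _ _ m.+1%:R); rewrite ?ler_nat ?geq_minl // -natr1 lerD2r.
have := H i j u t v ij jn _ ut tv _.
rewrite ler_pdivrMr // ler_pdivlMr // => /(_ i1 vj) /le_trans; apply.
rewrite ler_pM2r; last by lra.
rewrite -[2 * k]mulrC -mulrA; apply: ler_wpM2l => //.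
have -> : 2 * Num.sqrt (v - u) = Num.sqrt (2 ^+ 2 * (v - u)).
  by rewrite sqrtrM ?sqr_ge0 // sqrtr_sqr ger0_norm.
apply: ler_wsqrtr; rewrite -mulrBl ler_pdivrMr //.
have : 1 <= (v - u) * n%:R by rewrite -ler_pdivrMr // mul1r; lra.
rewrite -natr1 in i2; lra.
Qed.

End Criteria.

(** * Rates over Hoelder classes *)

Section HolderRates.
Context {R : realType}.
Implicit Types (s M l K : R) (f : R -> R).

Lemma holder_class_continuous s M f : 0 < s -> 0 < M -> holder_class s M f ->
  {within `[0, 1], continuous f}.
Proof.
rewrite /holder_class => s0 M0; case: ifP => _; first exact: holder01_continuous.
by move=> [df _]; exact: derivable01_continuous.
Qed.

Lemma integrable01_continuous f : {within `[0, 1], continuous f} ->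
  (@lebesgue_measure R).-integrable `[0, 1] (EFin \o f).
Proof.
move=> cf; apply: continuous_compact_integrable => //; exact: segment_compact.
Qed.

Lemma powR_sub1 l s : 0 < l -> l `^ (s - 1) = l `^ s / l.
Proof.
move=> l0; rewrite powRB; last by rewrite (gt_eqF l0) implybT.
by rewrite powRr1 ?ltW.
Qed.

(** The window of length [l] starts at [t], or ends at 1 when [t] is too close to
    1. On this window [deriv01 f] is at least
    [deriv01 f t - M * l ^ (s - 1)]. *)
Lemma holder_deriv_le s M l K f : 1 < s -> 0 < M -> 0 < l -> l <= 1 -> 0 <= K ->
  derivable01 f -> holder01 (s - 1) M (deriv01 f) ->
  small_gaps (primitive f) l (K * (M * l `^ s) * Num.sqrt l) ->
  forall t, t \in `[0, 1] -> deriv01 f t <= (1 + 18 * K) * (M * l `^ s / l).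
Proof.
move=> s1 M0 l0 l1 K0 df hf H t; rewrite in_itv /= => /andP[t0 t1].
set r := M * l `^ s in H *.
have r0 : 0 < r by rewrite mulr_gt0 // powR_gt0.
have rl0 : 0 < r / l by rewrite divr_gt0.
pose A := deriv01 f t - r / l.
have [A0|A0] := leP A 0.
  have : 0 <= 18 * K * (r / l) by apply: mulr_ge0; [rewrite mulr_ge0|exact: ltW].
  by rewrite /A in A0; lra.
have fi : (@lebesgue_measure R).-integrable `[0, 1] (EFin \o f).
  by apply: integrable01_continuous; exact: derivable01_continuous.
pose u := Num.min t (1 - l).
have [u0 ut tu u1] : [/\ 0 <= u, u <= t, t <= u + l & u + l <= 1].
  rewrite /u; case: (leP t (1 - l)) => h; split; lra.
have slope x y : u <= x -> x <= y -> y <= u + l -> A * (y - x) <= f y - f x.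
  move=> ux xy yu.
  have x0 : 0 <= x by lra.
  have y1 : y <= 1 by lra.
  have [c + ->] := rise_deriv01 df x0 xy y1.
  rewrite in_itv /= => /andP[xc cy]; apply: ler_wpM2r; first by lra.
  have tab : t \in `[0, 1] by rewrite in_itv /= t0.
  have cab : c \in `[0, 1] by rewrite in_itv /=; apply/andP; split; lra.
  have := hf _ _ tab cab.
  have : M * `|t - c| `^ (s - 1) <= r / l.
    rewrite /r -mulrA -powR_sub1 //; apply: ler_wpM2l; first exact: ltW.
    apply: ge0_ler_powR; rewrite ?nnegrE ?(ltW l0) //; first by lra.
    by rewrite ler_norml; apply/andP; split; lra.
  have := ler_norm (deriv01 f t - deriv01 f c); rewrite /A; lra.
have := slope_le fi l0 H u0 u1 (ltW A0) slope.
have sE : Num.sqrt l * Num.sqrt l = l by rewrite -expr2 sqr_sqrtr // ltW.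
have -> : 18 * (K * r * Num.sqrt l) * Num.sqrt l = 18 * K * r * l.
  by rewrite -[in RHS]sE; lra.
have rE : r / l * l = r by rewrite divfK // gt_eqF.
have l20 : 0 < l ^+ 2 by rewrite exprn_gt0.
rewrite -[X in 18 * K * X * l]rE => h.
have : A <= 18 * K * (r / l) by rewrite -(ler_pM2r l20); lra.
rewrite /A; lra.
Qed.

(** The rise over lengths at most [2 * l] comes from the Hoelder condition on [f]
    when [s <= 1], and from the one-sided bound of [holder_deriv_le] on its
    derivative otherwise. *)
Lemma holder_rise_le s M l K f : 0 < s -> 0 < M -> 0 < l ->
  (1 < s -> l <= 1) -> 0 <= K -> holder_class s M f ->
  small_gaps (primitive f) l (K * (M * l `^ s) * Num.sqrt l) ->
  forall x y, 0 <= x -> x <= y -> y <= 1 ->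
    f y - f x <= (4 + 82 * K) * (M * l `^ s).
Proof.
move=> s0 M0 l0 l1 K0 hf H x y x0 xy y1.
have fi : (@lebesgue_measure R).-integrable `[0, 1] (EFin \o f).
  by apply: integrable01_continuous; exact: holder_class_continuous hf.
set r := M * l `^ s in H *.
have r0 : 0 < r by rewrite mulr_gt0 // powR_gt0.
have s0' : 0 < Num.sqrt l by rewrite sqrtr_gt0.
have Kr : 0 <= K * r by rewrite mulr_ge0 // ltW.
pose B := 2 * (1 + 18 * K) * r.
have B0 : 0 <= B by rewrite /B; nra.
have k0 : 0 <= K * r * Num.sqrt l by rewrite mulr_ge0 // ltW.
have := rise_le fi l0 k0 H B0 _ x0 xy y1.
rewrite mulfK ?gt_eqF // => /(_ _)/le_trans; apply; last by rewrite /B; nra.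
move=> u v u0 uv v1 uvl.
move: hf; rewrite /holder_class; case: ifPn => [s1 hf|].
  have uab : u \in `[0, 1] by rewrite in_itv /=; apply/andP; split; lra.
  have vab : v \in `[0, 1] by rewrite in_itv /=; apply/andP; split; lra.
  have := hf _ _ vab uab.
  have : M * `|v - u| `^ s <= 2 * r.
    have -> : 2 * r = M * (2 * l `^ s) by rewrite /r; lra.
    apply: ler_wpM2l; first exact: ltW.
    apply: (@le_trans _ _ ((2 * l) `^ s)).
      apply: ge0_ler_powR; rewrite ?nnegrE ?(ltW s0) //.
        by rewrite mulr_ge0 // ltW.
      by rewrite ger0_norm; lra.
    rewrite powRM ?(ltW l0) //; apply: ler_wpM2r; first exact: powR_ge0.
    by rewrite -[leRHS]powRr1 //; apply: ler_powR; rewrite // ler1n.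
  by have := ler_norm (f v - f u); rewrite /B; lra.
rewrite -ltNge => s1 [df hf].
have [c + ->] := rise_deriv01 df u0 uv v1.
rewrite in_itv /= => /andP[uc cv].
have cab : c \in `[0, 1] by rewrite in_itv /=; apply/andP; split; lra.
have := holder_deriv_le s1 M0 l0 (l1 s1) K0 df hf H cab; rewrite -/r => dc.
apply: le_trans (ler_wpM2r _ dc) _; first by lra.
have rl0 : 0 < r / l by rewrite divr_gt0.
have a0 : 0 <= (1 + 18 * K) * (r / l) by rewrite mulr_ge0 ?(ltW rl0) //; lra.
apply: le_trans (ler_wpM2l a0 uvl) _.
have rE : r / l * l = r by rewrite divfK // gt_eqF.
by rewrite /B -[in leRHS]rE; lra.
Qed.

(** [l] is the scale at which [M * l ^ s], the variation of [f], equals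
    [sqrt e2 / sqrt l], which is the order of the noise in the average over an
    interval of length [l], uniformly over the grid, for
    [e2 = sigma ^ 2 * ln n / n]. *)
Lemma bandwidthP s M e2 (l := (e2 / M ^+ 2) `^ (1 / (1 + 2 * s))) :
  0 < s -> 0 < M -> 0 < e2 ->
  [/\ 0 < l, M * l `^ s = M `^ (1 / (1 + 2 * s)) * e2 `^ (s / (1 + 2 * s)),
      M * l `^ s / l = M `^ (3 / (1 + 2 * s)) * e2 `^ ((s - 1) / (1 + 2 * s))
    & M * l `^ s * Num.sqrt l = Num.sqrt e2].
Proof.
move=> s0 M0 e20.
have q0 : 0 < e2 / M ^+ 2 by rewrite divr_gt0 // exprn_gt0.
have l0 : 0 < l by rewrite powR_gt0.
pose m := ln M; pose e := ln e2; pose d := (1 + 2 * s)^-1.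
have dE : d * (1 + 2 * s) = 1 by rewrite mulVf // gt_eqF //; lra.
have ME : M = expR m by rewrite lnK.
have eE : e2 = expR e by rewrite lnK.
have powE (x : R) a : 0 < x -> x `^ a = expR (a * ln x).
  by move=> x0; rewrite /powR gt_eqF.
have lE : l = expR (d * (e - 2 * m)).
  rewrite /l powE // ln_div ?posrE ?exprn_gt0 // lnXn // div1r -/d.
  by rewrite -/m -/e; congr expR; lra.
have lsE : l `^ s = expR (s * (d * (e - 2 * m))) by rewrite powE // lE expRK.
have dm : d * m + 2 * s * d * m = m by have /= := congr1 ( *%R^~ m) dE; lra.
have de : d * e + 2 * s * d * e = e by have /= := congr1 ( *%R^~ e) dE; lra.
split => //.
- rewrite lsE !powE // -/m -/e [in LHS]ME -!expRD; congr expR.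
  by rewrite div1r -/d; lra.
- rewrite lsE lE !powE // -/m -/e [in LHS]ME -expRN -!expRD; congr expR.
  by rewrite -/d; lra.
- apply/eqP; rewrite -(@eqrXn2 _ 2) ?sqrtr_ge0 //; last first.
    by rewrite !mulr_ge0 ?sqrtr_ge0 ?powR_ge0 // ltW.
  rewrite exprMn !sqr_sqrtr ?(ltW e20) ?(ltW l0) //.
  rewrite lsE lE ME eE -expRD -expRM_natl -expRD; apply/eqP; congr expR.
  lra.
Qed.

Lemma bandwidth_ge s M e2 N (l := (e2 / M ^+ 2) `^ (1 / (1 + 2 * s))) :
  0 < s -> 0 < M -> 0 < e2 -> 0 < N ->
  M ^+ 2 <= N `^ (2 * s) * (N * e2) -> N^-1 <= l.
Proof.
move=> s0 M0 e20 N0 h.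
have q0 : 0 < 1 + 2 * s by lra.
have -> : N^-1 = (N^-1 `^ (1 + 2 * s)) `^ (1 / (1 + 2 * s)).
  by rewrite -powRrM div1r divff ?gt_eqF // powRr1 // invr_ge0 ltW.
rewrite /l; apply: ge0_ler_powR.
- by rewrite divr_ge0 // ltW.
- by rewrite nnegrE powR_ge0.
- by rewrite nnegrE divr_ge0 ?exprn_ge0 // ltW.
rewrite ler_pdivlMr ?exprn_gt0 //.
have p0 : 0 < N `^ (1 + 2 * s) by rewrite powR_gt0.
have -> : N^-1 `^ (1 + 2 * s) = (N `^ (1 + 2 * s))^-1.
  by rewrite -powRN -[N^-1]powR_inv1 ?(ltW N0) // -powRrM mulN1r.
rewrite ler_pdivrMl //; apply: le_trans h _.
rewrite powRD; last by rewrite (gt_eqF N0) implybT.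
by rewrite powRr1 ?(ltW N0) //; lra.
Qed.

Lemma bandwidth_le1 s M e2 (l := (e2 / M ^+ 2) `^ (1 / (1 + 2 * s))) :
  0 < s -> 0 < M -> 0 < e2 -> e2 <= M ^+ 2 -> l <= 1.
Proof.
move=> s0 M0 e20 h.
apply: (@le_trans _ _ (1 `^ (1 / (1 + 2 * s)))); last by rewrite powR1.
apply: ge0_ler_powR.
- by rewrite divr_ge0 //; lra.
- by rewrite nnegrE divr_ge0 ?exprn_ge0 // ltW.
- by rewrite nnegrE.
by rewrite ler_pdivrMr ?exprn_gt0 // mul1r.
Qed.

End HolderRates.

Theorem theorem3p2 (R : realType) (s alpha beta : R) :
  0 < s <= 2 -> 0 < alpha < 1 -> 0 < beta < 1 ->
  exists2 C : R, 0 < C &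
  forall (n : nat) (sigma M : R)
    (d : measure_display) (T : measurableType d) (P : probability T R)
    (W : R -> {RV P >-> R}),
  (2 <= n)%N -> 0 < sigma -> 0 < M -> brownian_motion01 W ->
  M / sigma <= n%:R `^ s * Num.sqrt (ln n%:R) ->
  (1 < s -> 2 `^ (1 + 2 * s) * sigma * Num.sqrt (ln n%:R / n%:R) <= M) ->
  (separation_rate P (Tn_rejects W n sigma alpha) beta (holder_class s M) Delta1
    <= (C * M `^ (1 / (1 + 2 * s))
          * (sigma ^+ 2 * ln n%:R / n%:R) `^ (s / (1 + 2 * s)))%:E)%E /\
  (1 < s ->
    (separation_rate P (Tn_rejects W n sigma alpha) beta (holder_class s M) Delta2
      <= (C * M `^ (3 / (1 + 2 * s))
            * (sigma ^+ 2 * ln n%:R / n%:R) `^ ((s - 1) / (1 + 2 * s)))%:E)%E).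
Proof.
move=> /andP[s0 s2] alpha01 beta01.
have [K K0 power] := Tn_power alpha01 beta01.
have C0 : 0 < 5 + 164 * K by lra.
have K20 : 0 <= 2 * K by lra.
exists (5 + 164 * K) => //.
move=> n sigma M d T P W n2 sigma0 M0 WB hn hM.
have n2R : 2 <= n%:R :> R by rewrite ler_nat.
have n0R : 0 < n%:R :> R by lra.
have n0 : (0 < n)%N by apply: leq_trans n2.
have L0 : 0 < ln (n%:R : R) by rewrite ln_gt0 //; lra.
set e2 := sigma ^+ 2 * ln n%:R / n%:R.
have e20 : 0 < e2 by rewrite divr_gt0 // mulr_gt0 // exprn_gt0.
pose l := (e2 / M ^+ 2) `^ (1 / (1 + 2 * s)).
have [l0 rE rlE epsE] := bandwidthP s0 M0 e20; rewrite -/l in l0 rE rlE epsE.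
have sqrt_e2 : Num.sqrt e2 = sigma / Num.sqrt n%:R * Num.sqrt (ln n%:R).
  rewrite /e2 -mulrA sqrtrM ?sqr_ge0 // sqrtr_sqr gtr0_norm //.
  by rewrite sqrtrM ?(ltW L0) // sqrtrV ?(ltW n0R) // -mulrA [_ * _^-1]mulrC.
have nl : n%:R^-1 <= l.
  apply: bandwidth_ge => //.
  have -> : n%:R * e2 = sigma ^+ 2 * ln n%:R by rewrite /e2 mulrC divfK // gt_eqF.
  have XE : (n%:R `^ s * Num.sqrt (ln n%:R)) ^+ 2 = n%:R `^ (2 * s) * ln (n%:R : R).
    rewrite exprMn (sqr_sqrtr (ltW L0)) -(powR_mulrn _ (powR_ge0 _ _)) -powRrM.
    by rewrite [s * _]mulrC.
  have X0 : 0 <= n%:R `^ s * Num.sqrt (ln (n%:R : R)).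
    by rewrite mulr_ge0 ?powR_ge0 ?sqrtr_ge0.
  have ME : M = M / sigma * sigma by rewrite divfK // gt_eqF.
  have h2 : (M / sigma) ^+ 2 <= (n%:R `^ s * Num.sqrt (ln n%:R)) ^+ 2.
    by rewrite ler_pXn2r ?nnegrE // divr_ge0 // ltW.
  have := ler_wpM2r (sqr_ge0 sigma) h2; rewrite -exprMn -ME XE; lra.
have l1 : 1 < s -> l <= 1.
  move=> s1; apply: bandwidth_le1 => //.
  have h : sigma * Num.sqrt (ln n%:R / n%:R) <= M.
    apply: le_trans (hM s1); rewrite -mulrA ler_peMl //.
      by rewrite mulr_ge0 ?sqrtr_ge0 // ltW.
    apply: (@le_trans _ _ (2 `^ 0)); first by rewrite powRr0.
    by apply: ler_powR; lra.
  have -> : e2 = (sigma * Num.sqrt (ln n%:R / n%:R)) ^+ 2.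
    by rewrite exprMn sqr_sqrtr ?mulrA // divr_ge0 ?ltW.
  by rewrite ler_pXn2r ?nnegrE ?(ltW M0) // mulr_ge0 ?sqrtr_ge0 // ltW.
have small f : holder_class s M f ->
    ~ ((1 - beta)%:E <= P (Tn_rejects W n sigma alpha f))%E ->
    small_gaps (primitive f) l (2 * K * (M * l `^ s) * Num.sqrt l).
  move=> hf nrej.
  have fi := integrable01_continuous (holder_class_continuous s0 M0 hf).
  have -> : 2 * K * (M * l `^ s) * Num.sqrt l = 2 * (K * Num.sqrt e2).
    by rewrite -epsE; lra.
  apply: grid_small_gaps nl _ => //; first by rewrite mulr_ge0 ?sqrtr_ge0 // ltW.
  move=> i j u t v ij jn au ut tv vb; rewrite leNgt; apply/negP => big.
  apply: nrej; apply: power => //; first exact: within_primitive.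
  by exists i, j, u, t, v; split => //; rewrite -sqrt_e2.
split=> [|s1].
  have r0 : 0 < M * l `^ s by rewrite mulr_gt0 // powR_gt0.
  rewrite -mulrA -rE; apply: ereal_inf_lbound.
  exists ((5 + 164 * K) * (M * l `^ s)) => //; split; first exact: mulr_gt0.
  move=> f hf hD; apply: contrapT => /(small f hf) gaps.
  have := Delta1_le_rise (holder_rise_le s0 M0 l0 l1 K20 hf gaps).
  move=> /(le_trans hD); rewrite lee_fin ler_pM2r //; lra.
have r0 : 0 < M * l `^ s / l by rewrite divr_gt0 // mulr_gt0 // powR_gt0.
rewrite -mulrA -rlE; apply: ereal_inf_lbound.
exists ((5 + 164 * K) * (M * l `^ s / l)) => //; split; first exact: mulr_gt0.
move=> f hf hD; apply: contrapT => /(small f hf) gaps.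
move: (hf); rewrite /holder_class leNgt s1 /= => -[df hdf].
have := Delta2_le (holder_deriv_le s1 M0 l0 (l1 s1) K20 df hdf gaps).
move=> /(le_trans hD); rewrite lee_fin ler_pM2r //; lra.
Qed.
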